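(* Let $K$ be a field of characteristic $p>0$ with algebraic closure $K^{alg}$, let $n\ge1$ and $\underline f=(f_1,\dots,f_n)\in K^n$ with $\Delta_n(\underline f)\ne0$. Let $V$ be the $\mathbb{F}_p$-vector space $\dfrac{(\sum_{i=1}^n\mathbb{F}_pf_i)+(F-\mathrm{Id})(K)}{(F-\mathrm{Id})(K)}$, of dimension $r\le n$, and let $I\sqcup J$ be a partition of $\{1,\dots,n\}$ such that the $f_i$, $i\in I$, induce an $\mathbb{F}_p$-basis of $V$. Let $A$ be the $K$-algebra $K[W_k,1\le k\le n]/(P_k)_{1\le k\le n}$ where $P_k:=W_k^p-W_k-f_k$. (1) $A$ is an étale $K$-algebra isomorphic to $L^{p^{n-r}}$, the cartesian product of $p^{n-r}$ copies of $L$, where $L\subset K^{alg}$ is a field which is a Galois extension of $K$ with group $(\mathbb{Z}/p\mathbb{Z})^r$, and $L\simeq K[W_k,k\in I]/(P_k)_{k\in I}$. (2) The group $\operatorname{Aut}_KA$ of $K$-algebra automorphisms of $A$ is isomorphic to a semidirect product of the groups $\mathfrak{S}_{p^{n-r}}$ and $((\mathbb{Z}/p\mathbb{Z})^r)^{p^{n-r}}$. (3) Let $w_i$ be the canonical image of $W_i$ in $A$ and let $$w:=\begin{vmatrix}w_1&w_2&\cdots&w_n\\ f_1&f_2&\cdots&f_n\\ f_1^p&f_2^p&\cdots&f_n^p\\ \vdots&\vdots&\cdots&\vdots\\ f_1^{p^{n-2}}&f_2^{p^{n-2}}&\cdots&f_n^{p^{n-2}}\end{vmatrix}\in K[w_1,\dots,w_n].$$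 Put $d_i:=(-1)^{i-1}\Delta_{n-1}(\underline{\hat f_i})$. Then for $1\le i\le n$ $$w_i=\frac{\Delta_n(d_1,\dots,d_{i-1},w,d_{i+1},\dots,d_n)}{\Delta_n(d_1,\dots,d_n)}-(f_i+f_i^p+\cdots+f_i^{p^{n-2}})\in K[w],$$ and $$A=K[w_1,\dots,w_n]=K[w]\simeq K[W]/(Q(W)),\qquad Q(w)=0,$$ where $$Q(W)=\frac{\Delta_{n+1}(\Delta_{n-1}(\underline{\hat f_1}),\dots,\Delta_{n-1}(\underline{\hat f_n}),W)}{\Delta_n(\Delta_{n-1}(\underline{\hat f_1}),\dots,\Delta_{n-1}(\underline{\hat f_n}))}-\Delta_n(\underline f)^{p^{n-1}}$$ $$=W^{p^n}+\Big(\sum_{i=1}^{n-1}(-1)^{n-i}\Delta_n(\underline f)^{p^{n-1}-p^{i-1}-p^i}\,\big(\Delta[n-i](\underline f)\big)^{p^{i-1}}W^{p^i}\Big)+(-1)^n\Delta_n(\underline f)^{p^{n-1}-1}W-\Delta_n(\underline f)^{p^{n-1}}.$$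
   Context: Here $q=p$. $F$ is the Frobenius $F(x)=x^p$. For $\underline a=(a_1,\dots,a_n)$ in a commutative ring containing $\mathbb{F}_p$, $\Delta_n(\underline a):=\det\big(a_j^{p^{i-1}}\big)_{1\le i,j\le n}$ is the Moore determinant, with $\Delta_0:=1$; for $\underline a\in K^n$, $\Delta_n(\underline a)\ne0$ iff the $a_i$ are $\mathbb{F}_p$-linearly independent. $\underline{\hat f_i}:=(f_1,\dots,f_{i-1},f_{i+1},\dots,f_n)$. For $0\le i\le n$, $\Delta[i](\underline f)$ is the determinant of the $n\times n$ matrix with rows $\underline f,F(\underline f),\dots,F^n(\underline f)$ with the row $F^i(\underline f)$ omitted, where $F^k(\underline f)=(f_1^{p^k},\dots,f_n^{p^k})$. For $n=1$, the sums $f_i+\cdots+f_i^{p^{n-2}}$ and $\sum_{i=1}^{n-1}$ are empty and $w=w_1$. *)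

(* Defs.v *)
From HB Require Import structures.
From mathcomp Require Import all_boot all_order all_algebra.
From mathcomp Require Import all_fingroup all_solvable all_field.
From mathcomp Require Import generic_quotient ring_quotient qpoly.
From mathcomp Require Import boolp.
From mathcomp Require Import mpoly.

Set Implicit Arguments.
Unset Strict Implicit.
Unset Printing Implicit Defensive.

Import GRing.Theory.
Local Open Scope ring_scope.
Local Open Scope quotient_scope.

Definition moore (R : comNzRingType) (p n : nat) (a : 'I_n -> R) : R :=
  \det (\matrix_(i < n, j < n) a j ^+ (p ^ i)).

(* Delta[i]: [bump i] enumerates the Frobenius powers 0, ..., n without i. *)
Definition moore_omit (R : comNzRingType) (p n : nat) (i : nat)
    (a : 'I_n -> R) : R :=
  \det (\matrix_(k < n, j < n) a j ^+ (p ^ bump i k)).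

Definition hat (T : Type) (n : nat) (f : 'I_n -> T) (i : 'I_n) : 'I_n.-1 -> T :=
  fun k => f (lift i k).

Section Ideal.
Variables (R : comNzRingType) (m : nat) (P : 'I_m -> R).

Definition in_gen_ideal (x : R) : Prop :=
  exists c : 'I_m -> R, x = \sum_(k < m) c k * P k.

End Ideal.

(* [AScoker] is K / (F - Id)(K). The unused argument [pK] of [ASimage] lets the
   subgroup instance, which needs characteristic p, be found by inference. *)
Section Cokernel.
Variables (K : fieldType) (p : nat).

Definition ASimage (pK : p \in [pchar K]) : {pred K} :=
  fun x => `[< exists y : K, x = y ^+ p - y >].

Variable pK : p \in [pchar K].

Fact ASimage_zmod_closed : zmod_closed (ASimage pK).
Proof.
split; first by apply/asboolP; exists 0; rewrite expr0n subr0
  (gtn_eqF (prime_gt0 (pcharf_prime pK))).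
move=> x y /asboolP[a ->] /asboolP[b ->]; apply/asboolP; exists (a - b).
have := pFrobenius_autB_comm pK (mulrC a b); rewrite !pFrobenius_autE => ->.
by rewrite !opprD !opprK addrACA.
Qed.

HB.instance Definition _ :=
  GRing.isZmodClosed.Build K (ASimage pK) ASimage_zmod_closed.

Definition AScoker : zmodType := {ideal_quot (ASimage pK)}.

Definition AScls (x : K) : AScoker := \pi_({ideal_quot (ASimage pK)}) x.

(* The subspace ((sum_i F_p f_i) + (F - Id)(K)) / (F - Id)(K); a scalar c of
   'F_p acts as the natural multiple [_ *+ c], K being of characteristic p. *)
Definition ASspace (n : nat) (f : 'I_n -> K) (v : AScoker) : Prop :=
  exists (c : 'I_n -> 'F_p) (y : K),
    v = AScls (\sum_(i < n) f i *+ c i + (y ^+ p - y)).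

Definition ASbasis (n : nat) (f : 'I_n -> K) (m : nat) (v : 'I_m -> AScoker)
    : Prop :=
  [/\ forall k, ASspace f (v k),
      forall c : 'I_m -> 'F_p, \sum_(k < m) v k *+ c k = 0 ->
        forall k, c k = 0
    & forall x, ASspace f x ->
        exists c : 'I_m -> 'F_p, x = \sum_(k < m) v k *+ c k].

Definition ASdim (n : nat) (f : 'I_n -> K) (r : nat) : Prop :=
  exists v : 'I_r -> AScoker, ASbasis f v.

End Cokernel.

(* A ring in which all the equations x_k ^ p - x_k = g_k have a solution; it
   shows that the ideal (P_k) is proper. *)
Lemma AS_solvable (p m : nat) (R : comNzRingType) (g : 'I_m -> R) : (1 < p)%N ->
  exists (S : comNzRingType) (h : {rmorphism R -> S}) (x : 'I_m -> S),
    forall k, x k ^+ p - x k - h (g k) = 0.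
Proof.
move=> p1; elim: m g => [|m IHm] g; first by exists R, idfun, (fun _ => 0); case.
have [S [h [x hx]]] := IHm (fun k => g (lift ord0 k)).
pose c := h (g ord0); pose P : {poly S} := 'X^p - ('X + c%:P).
have sXC : (size ('X + c%:P)%R < p.+1)%N by rewrite size_XaddC ltnS.
have sP : size P = p.+1 by rewrite /P size_polyDl ?size_polyN size_polyXn.
have mP : P \is monic.
  by rewrite monicE lead_coefDl ?size_polyN ?size_polyXn // lead_coefXn.
have mkP : mk_monic P = P by rewrite /mk_monic sP mP ltnS (ltnW p1).
pose j : {rmorphism {poly S} -> {poly %/ P}} := in_qpoly P.
have jP : j P = 0.
  apply/val_inj; rewrite /= mkP.
  exact: (Pdiv.RingMonic.rmodpp mP).
exists {poly %/ P}, (j \o (polyC \o h)).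
exists (fun k => if unlift ord0 k is Some l then j (x l)%:P else j 'X) => k.
case: unliftP => [l ->|->] /=.
  by rewrite -rmorphXn -!rmorphB -polyC_exp -!polyCB hx /= rmorph0.
by rewrite -rmorphXn -!rmorphB -addrA -opprD.
Qed.

(* The K-algebra K[W_k, k < m] / (W_k ^ p - W_k - g_k). *)
Section ArtinSchreierAlgebra.
Variables (K : fieldType) (p : nat) (m : nat).

Definition ASpoly (g : 'I_m -> K) (k : 'I_m) : {mpoly K[m]} :=
  'X_k ^+ p - 'X_k - (g k)%:MP.

Definition ASideal (pK : p \in [pchar K]) (g : 'I_m -> K) :
    {pred {mpoly K[m]}} :=
  fun q => `[< in_gen_ideal (ASpoly g) q >].

Variables (pK : p \in [pchar K]) (g : 'I_m -> K).

Fact ASideal_closed : idealr_closed (ASideal pK g).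
Proof.
split.
- by apply/asboolP; exists (fun _ => 0); rewrite big1 // => k _; rewrite mul0r.
- apply/negP=> /asboolP[c c1].
  have [S [h [x hx]]] := AS_solvable g (prime_gt1 (pcharf_prime pK)).
  have := congr1 (mmap h x) c1.
  rewrite rmorph1 rmorph_sum big1 => [/eqP|k _]; first by rewrite oner_eq0.
  by rewrite rmorphM !rmorphB rmorphXn /= mmapX mmap1U mmapC hx mulr0.
- move=> a u v /asboolP[c ->] /asboolP[d ->]; apply/asboolP.
  exists (fun k => a * c k + d k); rewrite mulr_sumr -big_split.
  by apply: eq_bigr => k _; rewrite mulrDl mulrA.
Qed.

HB.instance Definition _ :=
  isIdealr.Build {mpoly K[m]} (ASideal pK g) ASideal_closed.

Definition ASalg : Type := {ideal_quot (ASideal pK g)}.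
HB.instance Definition _ := GRing.ComNzRing.on ASalg.

Definition ASpi : {mpoly K[m]} -> ASalg :=
  fun q => \pi_({ideal_quot (ASideal pK g)}) q.
HB.instance Definition _ := GRing.RMorphism.copy ASpi
  (\pi_({ideal_quot (ASideal pK g)}) : {mpoly K[m]} -> _).

Definition ASscale (a : K) (x : ASalg) : ASalg := ASpi a%:MP * x.

Fact ASscaleA a b x : ASscale a (ASscale b x) = ASscale (a * b) x.
Proof. by rewrite /ASscale mulrA -rmorphM /= -mpolyCM. Qed.
Fact ASscale1 : left_id 1 ASscale.
Proof. by move=> x; rewrite /ASscale !rmorph1 mul1r. Qed.
Fact ASscaleDr : right_distributive ASscale +%R.
Proof. by move=> a x y; rewrite /ASscale mulrDr. Qed.
Fact ASscaleDl x : {morph ASscale^~ x : a b / a + b}.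
Proof. by move=> a b; rewrite /ASscale !rmorphD mulrDl. Qed.
HB.instance Definition _ := GRing.Zmodule_isLmodule.Build K ASalg
  ASscaleA ASscale1 ASscaleDr ASscaleDl.
Fact ASscaleAl (a : K) (x y : ASalg) : a *: (x * y) = (a *: x) * y.
Proof. exact: mulrA. Qed.
HB.instance Definition _ := GRing.Lmodule_isLalgebra.Build K ASalg ASscaleAl.
HB.instance Definition _ := GRing.Lalgebra_isComAlgebra.Build K ASalg.

Definition ASvar (k : 'I_m) : ASalg := ASpi 'X_k.

End ArtinSchreierAlgebra.

Section Algebras.
Variable K : fieldType.

Definition finitely_presented (A : comAlgType K) : Prop :=
  exists (m : nat) (h : {lrmorphism {mpoly K[m]} -> A}),
    (forall a, exists q, h q = a) /\
    exists (s : nat) (P : 'I_s -> {mpoly K[m]}),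
      forall q, h q = 0 <-> in_gen_ideal P q.

(* The infinitesimal lifting criterion. Restricting to non-zero rings B and C
   loses nothing: a ring with a square-zero ideal and zero quotient is zero. *)
Definition formally_etale (A : comAlgType K) : Prop :=
  forall (B C : comAlgType K) (h : {lrmorphism B -> C}),
    (forall c, exists b, h b = c) ->
    (forall x y, h x = 0 -> h y = 0 -> x * y = 0) ->
    forall u : {lrmorphism A -> C},
      exists v : {lrmorphism A -> B},
        h \o v =1 u /\
        forall v' : {lrmorphism A -> B}, h \o v' =1 u -> v' =1 v.

Definition etale (A : comAlgType K) : Prop :=
  finitely_presented A /\ formally_etale A.

(* [Psi] is a group isomorphism from gT onto Aut_K(A) under composition. *)
Definition Aut_isog (A : comAlgType K) (gT : finGroupType) : Prop :=
  exists Psi : gT -> {lrmorphism A -> A},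
    [/\ forall s, bijective (Psi s),
        forall s t, Psi (s * t)%g =1 Psi s \o Psi t,
        forall s t, Psi s =1 Psi t -> s = t
      & forall phi : {lrmorphism A -> A}, bijective phi ->
          exists s, Psi s =1 phi].

End Algebras.

Section Data.
Variables (K : fieldType) (p n : nat) (f : 'I_n -> K).

Definition minor (i : 'I_n) : K := moore p (hat f i).

(* Indices start at 0, so that (-1)^(i-1) becomes (-1)^i. *)
Definition dcoef (i : 'I_n) : K := (-1) ^+ i * minor i.

Definition wdet (A : comAlgType K) (w : 'I_n -> A) : A :=
  \det (\matrix_(i < n, j < n)
    if i == 0 :> nat then w j else (f j ^+ (p ^ i.-1))%:A).

Definition Qpoly : {poly K} :=
  (moore p minor)^-1 *:
    moore p (fun k : 'I_n.+1 =>
      if unlift ord_max k is Some j then (minor j)%:P else 'X)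
  - (moore p f ^+ (p ^ n.-1))%:P.

End Data.

(* Main.v *)
Require Import Defs.
From HB Require Import structures.
From mathcomp Require Import all_boot all_algebra all_fingroup all_field.
From mathcomp Require Import generic_quotient boolp mpoly.
From mathcomp Require Import zify ring.

(* The signed minors d_j of the Moore matrix M = (f_j^(p^k)) are dual to the
   f_j: sum_j d_j^(p^k) f_j^(p^l) is 0 for k <= l < k + n - 1 and
   Delta^(p^l) for k = l + 1. If the w_j solve the equations W_j^p - W_j =
   f_j in a K-algebra and w = sum_j d_j w_j, then the x_j = w_j^(p^(n-1)),
   which differ from the w_j by elements of K, therefore satisfy sum_j
   d_j^(p^k) x_j = w^(p^k) for k < n, with a defect Delta^(p^(n-1)) for k =
   n. Conversely, for any w the first n equations have a unique solution x,
   given by Cramer's rule; it satisfies x_j^p - x_j = f_j^(p^(n-1)) if and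
   only if the equation for k = n holds with the same defect, and this
   equation is Q(w) = 0. So A and K[W]/(Q) represent the same functor. The
   coefficients of Q come from the companion matrix C with F(M) = C M:
   iterating M^-1 = F(M^-1) C gives an additive polynomial that vanishes on
   the d_j.

   The field L = K(z), for a root z of Q in Kalg, contains all the roots z +
   sum_j c_j d_j of Q, with c_j in F_p, hence is Galois. An automorphism s
   is determined by the differences s(alpha_i) - alpha_i in F_p for i in I,
   where alpha_i^p - alpha_i = f_i. If these vectors did not span F_p^r, a
   nonzero combination of the alpha_i would be fixed, hence in K,
   contradicting the independence of the f_i modulo (F - Id)(K). The points
   alpha + c of A in L, with c vanishing on I, represent the Galois orbits
   of points, and evaluation at them is the isomorphism from A to
   L^(p^(n-r)). An automorphism of L^N permutes the primitive idempotents
   and acts on each factor by an element of the Galois group. *)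

Set Implicit Arguments.
Unset Strict Implicit.
Unset Printing Implicit Defensive.

Import GRing.Theory.
Local Open Scope ring_scope.

(** * Powers of the Frobenius endomorphism *)

Section FrobeniusPower.
Variables (R : comNzRingType) (p : nat).

Definition frob (pR : p \in [pchar R]) (k : nat) (x : R) : R := x ^+ (p ^ k).

Variable pR : p \in [pchar R].

Lemma frobE k x : frob pR k x = x ^+ (p ^ k). Proof. by []. Qed.

Lemma frob0 x : frob pR 0 x = x. Proof. exact: expr1. Qed.

Lemma frob1 x : frob pR 1 x = x ^+ p. Proof. by []. Qed.

Lemma frob_comp k l x : frob pR k (frob pR l x) = frob pR (k + l) x.
Proof. by rewrite /frob -exprM -expnD addnC. Qed.

Lemma frobSr k x : frob pR k.+1 x = frob pR k (x ^+ p).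
Proof. by rewrite -addn1 -frob_comp. Qed.

Fact frob_zmod_morphism k : zmod_morphism (frob pR k).
Proof.
elim: k => [|k IHk] x y; first by rewrite !frob0.
rewrite -(add1n k) -!frob_comp IHk.
have := pFrobenius_autB_comm pR (mulrC (frob pR k x) (frob pR k y)).
by rewrite !pFrobenius_autE.
Qed.

Fact frob_monoid_morphism k : monoid_morphism (frob pR k).
Proof. by split=> [|x y]; rewrite /frob ?expr1n ?exprMn. Qed.

HB.instance Definition _ k :=
  GRing.isZmodMorphism.Build R R (frob pR k) (frob_zmod_morphism k).
HB.instance Definition _ k :=
  GRing.isMonoidMorphism.Build R R (frob pR k) (frob_monoid_morphism k).

End FrobeniusPower.

(** * Cofactors and Moore determinants *)

Section Cofactors.
Variables (R : comNzRingType) (n : nat).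

Lemma sum_mul_cofactor (A : 'M[R]_n) (i k : 'I_n) :
  \sum_j A i j * cofactor A k j = \det A *+ (i == k).
Proof.
have := congr1 (fun B : 'M_n => B i k) (mul_mx_adj A).
by rewrite !mxE => <-; apply: eq_bigr => j _; rewrite !mxE.
Qed.

Lemma cramer_rule (A : 'M[R]_n) (x : 'cV[R]_n) (i : 'I_n) :
  \det (\matrix_(k, j) if j == i then (A *m x) k 0 else A k j) = \det A * x i 0.
Proof.
transitivity ((\adj A *m (A *m x)) i 0); last first.
  by rewrite mulmxA mul_adj_mx mul_scalar_mx mxE.
rewrite (expand_det_col _ i) mxE; apply: eq_bigr => k _.
rewrite !mxE eqxx mulrC; congr (_ * _).
rewrite /cofactor; congr (_ * \det _); apply/matrixP=> a b.
by rewrite !mxE eq_sym (negPf (neq_lift _ _)).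
Qed.

End Cofactors.

Lemma signr_addnn (R : pzRingType) k : (-1) ^+ (k + k) = 1 :> R.
Proof. by rewrite exprD -expr2 sqrr_sign. Qed.

Section Moore.
Variables (R : comNzRingType) (p : nat).

Definition moore_mx n (a : 'I_n -> R) : 'M[R]_n :=
  \matrix_(i < n, j < n) a j ^+ (p ^ i).

Definition snoc n (a : 'I_n -> R) (x : R) : 'I_n.+1 -> R :=
  fun k => if unlift ord_max k is Some j then a j else x.

Lemma moore_snoc n (a : 'I_n -> R) (x : R) :
  moore p (snoc a x) =
  \sum_(k < n.+1) (-1) ^+ (k + n) * moore_omit p k a * x ^+ (p ^ k).
Proof.
rewrite /moore (expand_det_col _ ord_max); apply: eq_bigr => k _.
rewrite !mxE /snoc unlift_none mulrC; congr (_ * _).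
rewrite /cofactor /=; congr (_ * \det _).
by apply/matrixP=> i j; rewrite !mxE liftK.
Qed.

Lemma moore_snoc_mem n (a : 'I_n -> R) (i : 'I_n) : moore p (snoc a (a i)) = 0.
Proof.
rewrite /moore -det_tr.
apply: (@determinant_alternate _ _ _ (lift ord_max i) ord_max).
  by rewrite eq_sym neq_lift.
by move=> j; rewrite !mxE /snoc liftK unlift_none.
Qed.

Lemma moore_recurrence n (a : 'I_n -> R) (i : 'I_n) :
  \sum_(k < n.+1) (-1) ^+ (k + n) * moore_omit p k a * a i ^+ (p ^ k) = 0.
Proof. by rewrite -moore_snoc moore_snoc_mem. Qed.

Lemma moore_omit_max n (a : 'I_n -> R) : moore_omit p n a = moore p a.
Proof.
by congr (\det _); apply/matrixP=> i j; rewrite !mxE /bump leqNgt ltn_ord.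
Qed.

Variable pR : p \in [pchar R].

Lemma moore_omit0 n (a : 'I_n -> R) : moore_omit p 0 a = frob pR 1 (moore p a).
Proof.
rewrite /moore -det_map_mx; congr (\det _); apply/matrixP=> i j.
by rewrite !mxE /= -(frobE pR i) frob_comp.
Qed.

Lemma moore_sign n (a : 'I_n -> R) :
  moore p (fun j => (-1) ^+ j * a j) = (\prod_(j < n) (-1) ^+ j) * moore p a.
Proof.
rewrite mulrC.
have -> : \prod_(j < n) (-1) ^+ j =
    \det (diag_mx (\row_(j < n) (-1) ^+ j)) :> R.
  by rewrite det_diag; apply: eq_bigr => j _; rewrite mxE.
rewrite -det_mulmx; congr (\det _); apply/matrixP=> k j.
by rewrite mul_mx_diag !mxE -!(frobE pR) rmorphM rmorph_sign mulrC.
Qed.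

End Moore.

Section MooreMorphism.
Variables (R S : comNzRingType) (p : nat) (h : {rmorphism R -> S}).

Lemma map_moore_mx n (a : 'I_n -> R) :
  map_mx h (moore_mx p a) = moore_mx p (h \o a).
Proof. by apply/matrixP=> i j; rewrite !mxE rmorphXn. Qed.

Lemma moore_rmorph n (a : 'I_n -> R) : moore p (h \o a) = h (moore p a).
Proof. by rewrite -[in RHS]det_map_mx map_moore_mx. Qed.

Lemma moore_omit_rmorph n k (a : 'I_n -> R) :
  moore_omit p k (h \o a) = h (moore_omit p k a).
Proof.
rewrite /moore_omit -det_map_mx; congr (\det _).
by apply/matrixP=> i j; rewrite !mxE rmorphXn.
Qed.

End MooreMorphism.

(** * The signed minors of a Moore matrix *)

Section DualFamily.
Variables (K : fieldType) (p : nat) (pK : p \in [pchar K]).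
Variables (m : nat) (f : 'I_m.+1 -> K).

Local Notation F := (frob pK).
Local Notation d := (dcoef p f).
Local Notation Delta := (moore p f).

Lemma cofactor_moore_max j :
  cofactor (moore_mx p f) ord_max j = (-1) ^+ m * d j.
Proof.
rewrite /cofactor /dcoef mulrA -exprD; congr (_ * \det _).
by apply/matrixP=> a b; rewrite !mxE /= /bump leqNgt ltn_ord.
Qed.

Lemma cofactor_moore0 j : cofactor (moore_mx p f) ord0 j = F 1 (d j).
Proof.
rewrite /cofactor rmorphM rmorph_sign add0n; congr (_ * _).
rewrite -det_map_mx; congr (\det _); apply/matrixP=> i k.
by rewrite !mxE /= -(frobE pK i) frob_comp.
Qed.

Definition dual_pairing (k l : nat) : K := \sum_j F k (d j) * F l (f j).

Lemma dual_pairing_shift i k l :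
  dual_pairing (i + k) (i + l) = F i (dual_pairing k l).
Proof.
rewrite rmorph_sum; apply: eq_bigr => j _.
by rewrite [RHS]rmorphM /= !frob_comp.
Qed.

Lemma dual_pairing0_lt l : (l < m)%N -> dual_pairing 0 l = 0.
Proof.
move=> lm; have := sum_mul_cofactor (moore_mx p f) (widen_ord (leqnSn m)
  (Ordinal lm)) ord_max.
rewrite -val_eqE /= (ltn_eqF lm) mulr0n => cof0.
apply: (@lreg_sign K m); rewrite mulr0 -[RHS]cof0 mulr_sumr.
apply: eq_bigr => j _.
by rewrite cofactor_moore_max mxE frob0 mulrA mulrC.
Qed.

Lemma dual_pairing10 : dual_pairing 1 0 = Delta.
Proof.
rewrite -[RHS](sum_mul_cofactor (moore_mx p f) ord0 ord0).
by apply: eq_bigr => j _; rewrite cofactor_moore0 mxE mulrC.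
Qed.

Lemma dual_pairing_eq0 k l : (k <= l < k + m)%N -> dual_pairing k l = 0.
Proof.
move=> /andP[kl lkm].
by rewrite -(addn0 k) -(subnKC kl) dual_pairing_shift dual_pairing0_lt
  ?rmorph0 // ltn_subLR.
Qed.

Lemma dual_pairingS k : dual_pairing k.+1 k = F k Delta.
Proof. by rewrite -addn1 -{2}(addn0 k) dual_pairing_shift dual_pairing10. Qed.

Lemma frob_moore_mx_dcoef_tr :
  map_mx (F 1) (moore_mx p d) *m (moore_mx p f)^T =
  \matrix_(k, l) dual_pairing k.+1 l.
Proof.
apply/matrixP=> k l; rewrite !mxE; apply: eq_bigr => j _.
by rewrite !mxE -!(frobE pK) frob_comp.
Qed.

Lemma frob_moore_dcoef : F 1 (moore p d) * Delta = \prod_(k < m.+1) F k Delta.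
Proof.
rewrite -det_map_mx -[X in _ * X]det_tr -det_mulmx frob_moore_mx_dcoef_tr.
rewrite det_trig; last first.
  apply/is_trig_mxP => k l kl; rewrite mxE dual_pairing_eq0 //.
  by rewrite kl; have := ltn_ord l; lia.
by apply: eq_bigr => k _; rewrite mxE dual_pairingS.
Qed.

Hypothesis f_indep : Delta != 0.

Lemma moore_dcoef_neq0 : moore p d != 0.
Proof.
have : F 1 (moore p d) * Delta != 0.
  by rewrite frob_moore_dcoef; apply/prodf_neq0 => k _; rewrite fmorph_eq0.
by rewrite mulf_eq0 fmorph_eq0 negb_or => /andP[].
Qed.

Lemma moore_mx_dcoef_unit : moore_mx p d \in unitmx.
Proof. by rewrite unitmxE unitfE moore_dcoef_neq0. Qed.

Lemma moore_minor_neq0 : moore p (minor p f) != 0.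
Proof.
have := moore_dcoef_neq0; rewrite (moore_sign pK (minor p f)).
by rewrite mulf_eq0 negb_or => /andP[].
Qed.

Lemma frob_dcoef_free (u : 'I_m.+1 -> K) :
  (forall j, \sum_k u k * F k (d j) = 0) -> forall k, u k = 0.
Proof.
move=> ud0; pose v := \row_k u k.
have: v *m moore_mx p d = 0.
  apply/rowP=> j; rewrite !mxE -[RHS](ud0 j).
  by apply: eq_bigr => k _; rewrite !mxE.
move/(congr1 (mulmx^~ (invmx (moore_mx p d)))).
rewrite mulmxK ?moore_mx_dcoef_unit // mul0mx => /rowP v0 k.
by have := v0 k; rewrite !mxE.
Qed.

End DualFamily.

(** * The coefficients of Q *)

Section CoefficientsOfQ.
Variables (K : fieldType) (p : nat) (pK : p \in [pchar K]).
Variables (m : nat) (f : 'I_m.+1 -> K).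
Hypothesis f_indep : moore p f != 0.

Local Notation F := (frob pK).
Local Notation d := (dcoef p f).
Local Notation Delta := (moore p f).
Local Notation M := (moore_mx p f).

Definition qcoef (k : nat) : K :=
  (moore p (minor p f))^-1 * ((-1) ^+ (k + m.+1) * moore_omit p k (minor p f)).

Lemma qcoef_max : qcoef m.+1 = 1.
Proof.
by rewrite /qcoef signr_addnn mul1r moore_omit_max mulVf
  ?(moore_minor_neq0 pK).
Qed.

Lemma qcoef_dcoef j : \sum_(k < m.+2) qcoef k * F k (d j) = 0.
Proof.
rewrite -[RHS](mulr0 ((moore p (minor p f))^-1 * (-1) ^+ j)).
rewrite -[in RHS](moore_recurrence p (minor p f) j).
rewrite mulr_sumr; apply: eq_bigr => k _.
by rewrite rmorphM rmorph_sign /= frobE /qcoef; ring.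
Qed.

Lemma qcoef_unique (c : nat -> K) : c m.+1 = 1 ->
  (forall j, \sum_(k < m.+2) c k * F k (d j) = 0) ->
  forall k, (k <= m.+1)%N -> c k = qcoef k.
Proof.
move=> c_max c_dcoef k; rewrite leq_eqVlt => /predU1P[->|km].
  by rewrite c_max qcoef_max.
apply/eqP; rewrite -subr_eq0; apply/eqP.
apply: (frob_dcoef_free f_indep (u := fun k => c k - qcoef k) _ (Ordinal km)).
move=> j; transitivity (\sum_(k < m.+2) c k * F k (d j)
                       - \sum_(k < m.+2) qcoef k * F k (d j)).
  rewrite -sumrB [RHS]big_ord_recr /= c_max qcoef_max subrr addr0.
  by apply: eq_bigr => i _; rewrite mulrBl.
by rewrite c_dcoef qcoef_dcoef subrr.
Qed.

Lemma QpolyE : Qpoly p f =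
  \sum_(k < m.+2) qcoef k *: 'X^(p ^ k) - (F m Delta)%:P.
Proof.
rewrite /Qpoly /=; congr (_ - _).
rewrite (_ : moore p _ = moore p (snoc (polyC \o minor p f) 'X)) // moore_snoc.
rewrite scaler_sumr; apply: eq_bigr => k _.
rewrite moore_omit_rmorph /= -[(-1) ^+ _](rmorph_sign (@polyC K)) -polyCM.
by rewrite mul_polyC scalerA.
Qed.

Lemma size_Qpoly_subXn : (size (Qpoly p f - 'X^(p ^ m.+1))%R <= p ^ m.+1)%N.
Proof.
have p_pr := pcharf_prime pK.
rewrite QpolyE big_ord_recr /= qcoef_max scale1r addrAC addrK.
apply: leq_trans (size_polyD _ _) _; rewrite geq_max size_polyN.
rewrite (leq_trans (size_polyC_leq1 _)) ?expn_gt0 ?prime_gt0 ?andbT //.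
apply: leq_trans (size_sum _ _ _) _; apply/bigmax_leqP => k _.
apply: leq_trans (size_scale_leq _ _) _; rewrite size_polyXn.
by rewrite ltn_exp2l ?prime_gt1.
Qed.

Lemma size_Qpoly : size (Qpoly p f) = (p ^ m.+1).+1.
Proof.
rewrite -(subrK 'X^(p ^ m.+1) (Qpoly p f)) addrC size_polyDl size_polyXn //.
by rewrite ltnS size_Qpoly_subXn.
Qed.

Lemma size_Qpoly_gt1 : (1 < size (Qpoly p f))%N.
Proof. by rewrite size_Qpoly ltnS expn_gt0 prime_gt0 ?(pcharf_prime pK). Qed.

Lemma monic_Qpoly : Qpoly p f \is monic.
Proof.
rewrite -(subrK 'X^(p ^ m.+1) (Qpoly p f)) addrC monicE lead_coefDl
  ?lead_coefXn //.
by rewrite size_polyXn ltnS size_Qpoly_subXn.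
Qed.

Definition rec_coef (k : nat) : K :=
  (-1) ^+ (k + m.+1) * moore_omit p k f / Delta.

Lemma frob_recurrence j :
  F m.+1 (f j) = - \sum_(k < m.+1) rec_coef k * F k (f j).
Proof.
have := moore_recurrence p f j; rewrite big_ord_recr /= moore_omit_max.
rewrite signr_addnn mul1r => /eqP; rewrite addr_eq0 => /eqP f_rec.
apply: (mulfI f_indep); rewrite mulrN mulr_sumr.
rewrite -[LHS]opprK -{}f_rec; congr (- _); apply: eq_bigr => k _.
by rewrite /rec_coef frobE; field.
Qed.

Definition moore_companion : 'M[K]_m.+1 := \matrix_(l, k)
  if l == ord_max then - rec_coef k else (k == l.+1 :> nat)%:R.

Lemma frob_moore_mx : map_mx (F 1) M = moore_companion *m M.
Proof.
apply/matrixP=> l j; rewrite !mxE /= -(frobE pK l) frob_comp add1n.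
have [->|l_max] := eqVneq l ord_max.
  rewrite frob_recurrence -sumrN; apply: eq_bigr => k _.
  by rewrite !mxE eqxx mulNr.
have lm : (l.+1 < m.+1)%N.
  by rewrite ltn_neqAle ltn_ord andbT -val_eqE in l_max *.
rewrite (bigD1 (Ordinal lm)) //= !mxE (negPf l_max) eqxx mul1r big1 ?addr0 //.
move=> k; rewrite -val_eqE /= => /negPf kl.
by rewrite !mxE (negPf l_max) kl mul0r.
Qed.

Lemma invmx_moore_mx : invmx M = map_mx (F 1) (invmx M) *m moore_companion.
Proof.
have M_unit : M \in unitmx by rewrite unitmxE unitfE.
have FM_unit : map_mx (F 1) M \in unitmx by rewrite map_unitmx.
apply: (can_inj (mulKmx FM_unit)); apply: (can_inj (mulmxK M_unit)).
by rewrite mulmxKV // map_invmx mulKVmx // frob_moore_mx.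
Qed.

Lemma invmx_moore_rec j (k : 'I_m.+1) : invmx M j k =
  (if k == 0 :> nat then 0 else F 1 (invmx M j (inord k.-1)))
  - F 1 (invmx M j ord_max) * rec_coef k.
Proof.
rewrite {1}invmx_moore_mx mxE big_ord_recr /= !mxE eqxx mulrN; congr (_ - _).
have l_max (l : 'I_m) : (widen_ord (leqnSn m) l == ord_max) = false.
  by rewrite -val_eqE /= ltn_eqF.
case: (posnP k) => [k0|k_gt0].
  by rewrite big1 // => l _; rewrite !mxE l_max k0 mulr0.
have km : (k.-1 < m)%N by rewrite prednK // -ltnS ltn_ord.
rewrite (bigD1 (Ordinal km)) //= big1 => [|l lk].
  rewrite addr0 !mxE l_max prednK // eqxx mulr1; congr (F 1 (invmx _ _ _)).
  by apply/val_inj; rewrite /= inordK // ltnW.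
rewrite !mxE l_max -(prednK k_gt0) eqSS eq_sym; move: lk.
by rewrite -val_eqE /= => /negPf->; rewrite mulr0.
Qed.

Lemma invmx_moore_col j t : (t < m.+1)%N -> invmx M j (inord t) =
  - \sum_(k < t.+1) F (t - k) (F 1 (invmx M j ord_max) * rec_coef k).
Proof.
elim: t => [|t IHt] tm; rewrite invmx_moore_rec inordK //=.
  by rewrite big_ord1 sub0r frob0.
rewrite (IHt (ltnW tm)) [in RHS]big_ord_recr /= opprD subnn frob0.
rewrite rmorphN rmorph_sum; congr (- _ - _); apply: eq_bigr => k _.
by rewrite /= frob_comp add1n subSn // -ltnS ltn_ord.
Qed.

Lemma invmx_moore_max j : invmx M j ord_max = (-1) ^+ m * d j / Delta.
Proof.
rewrite /invmx unitmxE unitfE f_indep !mxE mulrC; congr (_ / _).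
exact: cofactor_moore_max.
Qed.

(* Reading [invmx_moore_col] at t = m gives the adjoint of the recurrence for
   the f_j: an additive polynomial that vanishes on the d_j. *)
Definition qcoef_closed (k : nat) : K :=
  if k is i.+1 then
    (-1) ^+ (m - i) * (F m Delta / (F i Delta * F i.+1 Delta))
      * F i (moore_omit p (m - i) f)
  else (-1) ^+ m.+1 * (F m Delta / Delta).

Lemma qcoef_closed_max : qcoef_closed m.+1 = 1.
Proof.
rewrite /= subnn mul1r (moore_omit0 pK) frob_comp addn1.
by field; rewrite !fmorph_eq0 f_indep.
Qed.

Lemma qcoef_closed_rec_coef j (i : nat) : (i <= m)%N ->
  qcoef_closed i.+1 * F i.+1 (d j) =
  - F m Delta * F i (F 1 (invmx M j ord_max) * rec_coef (m - i)).
Proof.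
move=> im; rewrite invmx_moore_max /= /rec_coef.
rewrite !(rmorphM (F _), fmorphV (F _)) /= !frob_comp addn1 !rmorph_sign.
have -> : (-1) ^+ (m - i + m.+1) = - (-1) ^+ i :> K.
  rewrite (_ : m - i + m.+1 = (m - i) + (m - i) + i.+1)%N; last by lia.
  by rewrite exprD signr_addnn mul1r exprS mulN1r.
have -> : (-1) ^+ (m - i) = (-1) ^+ m * (-1) ^+ i :> K.
  rewrite -exprD (_ : m + i = (m - i) + (i + i))%N; last by lia.
  by rewrite exprD signr_addnn mulr1.
by field; rewrite !fmorph_eq0 f_indep.
Qed.

Lemma qcoef_closedE k : (k <= m.+1)%N -> qcoef_closed k = qcoef k.
Proof.
apply: qcoef_unique => [|j]; first exact: qcoef_closed_max.
have max_sum := invmx_moore_col j (ltnSn m).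
rewrite (_ : inord m = ord_max) in max_sum; last first.
  by apply/val_inj; rewrite /= inordK.
rewrite (reindex_inj rev_ord_inj) in max_sum.
transitivity (- F m Delta * (invmx M j ord_max - invmx M j ord_max));
  last by rewrite subrr mulr0.
rewrite {2}max_sum opprK mulrDr mulr_sumr big_ord_recl; congr (_ + _).
  by rewrite invmx_moore_max /= frob0 exprS; field.
apply: eq_bigr => i _; have im : (i <= m)%N by rewrite -ltnS.
by rewrite /= /bump add1n qcoef_closed_rec_coef // subSS subKn.
Qed.

Lemma Qpoly_explicit : Qpoly p f =
  'X^(p ^ m.+1)
  + \sum_(1 <= i < m.+1)
      ((-1) ^+ (m.+1 - i)
       * Delta ^ ((p ^ m)%:Z - (p ^ i.-1)%:Z - (p ^ i)%:Z)
       * moore_omit p (m.+1 - i) f ^+ (p ^ i.-1)) *: 'X^(p ^ i)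
  + ((-1) ^+ m.+1 * Delta ^+ (p ^ m - 1)) *: 'X
  - (Delta ^+ (p ^ m))%:P.
Proof.
have p_gt0 := prime_gt0 (pcharf_prime pK).
rewrite QpolyE; congr (_ - _); rewrite big_ord_recl big_ord_recr /= qcoef_max.
rewrite [RHS]addrC scale1r; congr (_ + _).
  rewrite -qcoef_closedE // expn0 expr1; congr (_ * _ *: _).
  rewrite frobE -{1}(@subnK 1 (p ^ m)) ?expn_gt0 ?p_gt0 //.
  by rewrite addn1 exprSr mulfK.
rewrite [RHS]addrC big_add1 big_mkord; congr (_ + _); apply: eq_bigr => i _.
have im : (i.+1 <= m.+1)%N by rewrite ltnS ltnW.
rewrite /= /bump add1n -(qcoef_closedE im) /= subSS; congr (_ * _ * _ *: _).
by rewrite !expfzDr // -!exprnP -!exprnN -mulrA -invfM.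
Qed.

End CoefficientsOfQ.

(** * Subalgebras and generators *)

Section Subalgebra.
Variable K : comNzRingType.

Definition subalgebra (B : comAlgType K) (S : B -> Prop) : Prop :=
  [/\ forall a : K, S a%:A, forall x y, S x -> S y -> S (x + y)
    & forall x y, S x -> S y -> S (x * y)].

Definition generates (B : comAlgType K) (I : Type) (b : I -> B) : Prop :=
  forall S : B -> Prop, subalgebra S -> (forall i, S (b i)) -> forall x, S x.

Lemma subalgebra_range (B : comAlgType K) (C : nzRingType)
    (h : {rmorphism C -> B}) :
  (forall a : K, exists c, a%:A = h c) ->
  subalgebra (fun x => exists c, x = h c).
Proof.
move=> h_alg; split=> // [x y [c ->] [c' ->]|x y [c ->] [c' ->]].
  by exists (c + c'); rewrite rmorphD.
by exists (c * c'); rewrite rmorphM.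
Qed.

Lemma lrmorph_alg (B C : comAlgType K) (h : {lrmorphism B -> C}) (a : K) :
  h a%:A = a%:A.
Proof. by rewrite linearZ /= rmorph1. Qed.

Section Closure.
Variables (B : comAlgType K) (S : B -> Prop).
Hypothesis subS : subalgebra S.

Lemma subalgebra_alg (a : K) : S a%:A. Proof. by case: subS => /(_ a). Qed.

Lemma subalgebra0 : S 0.
Proof. by rewrite -(scale0r 1); apply: subalgebra_alg. Qed.

Lemma subalgebra1 : S 1.
Proof. by rewrite -(scale1r 1); apply: subalgebra_alg. Qed.

Lemma subalgebraD x y : S x -> S y -> S (x + y).
Proof. by case: subS => _ /(_ x y). Qed.

Lemma subalgebraM x y : S x -> S y -> S (x * y).
Proof. by case: subS => _ _ /(_ x y). Qed.

Lemma subalgebraZ (a : K) x : S x -> S (a *: x).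
Proof.
by move=> Sx; rewrite -mulr_algl; apply: subalgebraM => //;
  apply: subalgebra_alg.
Qed.

Lemma subalgebra_sum I (s : seq I) (F : I -> B) :
  (forall i, S (F i)) -> S (\sum_(i <- s) F i).
Proof.
by move=> SF; apply: big_ind => //; [apply: subalgebra0|apply: subalgebraD].
Qed.

Lemma subalgebraMn x n : S x -> S (x *+ n).
Proof. by move=> Sx; rewrite -scaler_nat; apply: subalgebraZ. Qed.

Lemma subalgebraX x n : S x -> S (x ^+ n).
Proof.
move=> Sx; elim: n => [|n IHn]; first exact: subalgebra1.
by rewrite exprS; apply: subalgebraM.
Qed.

Lemma subalgebra_horner x q : S x -> S (horner_alg x q).
Proof.
move=> Sx; elim/poly_ind: q => [|q a IHq].
  by rewrite rmorph0; apply: subalgebra0.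
rewrite rmorphD rmorphM /= horner_algX horner_algC.
by apply: subalgebraD; [apply: subalgebraM|apply: subalgebra_alg].
Qed.

End Closure.

Lemma generates_hom_ext (B C : comAlgType K) I (b : I -> B)
    (h h' : {lrmorphism B -> C}) :
  generates b -> (forall i, h (b i) = h' (b i)) -> h =1 h'.
Proof.
move=> b_gen hb; apply: (b_gen (fun x => h x = h' x)) => //.
split=> [a|x y hx hy|x y hx hy] /=; first by rewrite !lrmorph_alg.
  by rewrite !rmorphD /= hx hy.
by rewrite !rmorphM /= hx hy.
Qed.

Lemma generates_surj (B C : comAlgType K) I (c : I -> C)
    (h : {lrmorphism B -> C}) :
  generates c -> (forall i, exists x, c i = h x) -> forall y, exists x, y = h x.
Proof.
apply; apply: subalgebra_range => a; exists a%:A.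
by rewrite /= lrmorph_alg.
Qed.

Lemma lrmorph_horner_alg (B C : comAlgType K) (h : {lrmorphism B -> C}) x q :
  h (horner_alg x q) = horner_alg (h x) q.
Proof.
rewrite -[horner_alg x q]/((map_poly _ _).[_]) -horner_map -map_poly_comp.
by congr (_.[_]); apply: eq_map_poly => a; apply: lrmorph_alg.
Qed.

Lemma mpoly_generates n : generates (fun k => 'X_k : {mpoly K[n]}).
Proof.
move=> S subS SX; elim/mpolyind=> [|c M q _ _ Sq]; first exact: subalgebra0.
apply: subalgebraD => //; apply: subalgebraZ => //; rewrite mpolyXE_id.
elim/big_ind: _ => [|x y|k _]; first exact: subalgebra1.
  exact: subalgebraM.
exact: subalgebraX.
Qed.

Lemma generates_mmap (B : comAlgType K) n (b : 'I_n -> B) :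
  generates b -> forall x, exists q, x = mmap (in_alg B) b q.
Proof.
apply=> [|k]; last by exists 'X_k; rewrite mmapX mmap1U.
by apply: subalgebra_range => a; exists a%:MP; rewrite /= mmapC.
Qed.

End Subalgebra.

(** * The Artin-Schreier algebra *)

Definition AS_solution (K : fieldType) (p : nat) (B : comAlgType K) (I : Type)
    (g : I -> K) (b : I -> B) : Prop :=
  forall i, b i ^+ p - b i = (g i)%:A.

Lemma lrmorph_AS_solution (K : fieldType) p (B C : comAlgType K) I (g : I -> K)
    (b : I -> B) (h : {lrmorphism B -> C}) :
  AS_solution p g b -> AS_solution p g (h \o b).
Proof. by move=> bAS i; rewrite -rmorphXn -rmorphB bAS /= lrmorph_alg. Qed.

Lemma pchar_alg (K : fieldType) p (pK : p \in [pchar K]) (B : comAlgType K) :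
  p \in [pchar B].
Proof. by rewrite pchar_lalg. Qed.

Section UniversalProperty.
Variables (K : fieldType) (p : nat) (pK : p \in [pchar K]).
Variables (m : nat) (g : 'I_m -> K).

Local Notation A := (ASalg pK g).

Lemma ASpi_surj (x : A) : exists q, x = ASpi pK g q.
Proof. by exists (repr x); rewrite /ASpi reprK. Qed.

Lemma ASpi_eq0 q : ASpi pK g q = 0 <-> in_gen_ideal (ASpoly p g) q.
Proof.
rewrite -[0](rmorph0 (ASpi pK g)) /ASpi; split=> [/eqP|q_ideal].
  by rewrite -Quotient.idealrBE subr0 => /asboolP.
by apply/eqP; rewrite -Quotient.idealrBE subr0; apply/asboolP.
Qed.

Fact ASpi_scalable : scalable (ASpi pK g).
Proof. by move=> a q; rewrite -mul_mpolyC rmorphM. Qed.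

HB.instance Definition _ :=
  GRing.isScalable.Build K {mpoly K[m]} A *:%R (ASpi pK g) ASpi_scalable.

Lemma ASvar_generates : generates (ASvar pK g).
Proof.
move=> S [S_alg SD SM] S_var x; have [q ->] := ASpi_surj x.
apply: (mpoly_generates (S := fun q => S (ASpi pK g q))) => //.
split=> [a|u v Su Sv|u v Su Sv]; first by rewrite lrmorph_alg.
  by rewrite rmorphD; apply: SD.
by rewrite rmorphM; apply: SM.
Qed.

Lemma ASalg_hom_ext (B : comAlgType K) (h h' : {lrmorphism A -> B}) :
  (forall k, h (ASvar pK g k) = h' (ASvar pK g k)) -> h =1 h'.
Proof. exact: generates_hom_ext ASvar_generates. Qed.

Lemma ASvar_solution : AS_solution p g (ASvar pK g).
Proof.
move=> k; apply/eqP; rewrite -subr_eq0 -(lrmorph_alg (ASpi pK g)).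
rewrite -rmorphXn -!rmorphB; apply/eqP/ASpi_eq0.
exists (fun l => (l == k)%:R); rewrite (bigD1 k) //= eqxx mul1r big1 ?addr0.
  by rewrite /ASpoly -mul_mpolyC mulr1.
by move=> l /negPf ->; rewrite mul0r.
Qed.

Section Lift.
Variables (B : comAlgType K) (b : 'I_m -> B).

Definition ASlift (bAS : AS_solution p g b) (x : A) : B :=
  mmap (in_alg B) b (repr x).

Variable bAS : AS_solution p g b.

Lemma ASlift_pi q : ASlift bAS (ASpi pK g q) = mmap (in_alg B) b q.
Proof.
apply/eqP; rewrite /ASlift -subr_eq0 -rmorphB.
have /ASpi_eq0[c ->] : ASpi pK g (repr (ASpi pK g q) - q) = 0.
  by rewrite rmorphB /= {1}/ASpi reprK subrr.
rewrite rmorph_sum big1 // => k _.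
by rewrite rmorphM !rmorphB rmorphXn /= mmapX mmap1U mmapC bAS subrr mulr0.
Qed.

Fact ASlift_zmod_morphism : zmod_morphism (ASlift bAS).
Proof.
move=> x y; have [[q ->] [q' ->]] := (ASpi_surj x, ASpi_surj y).
by rewrite -rmorphB !ASlift_pi rmorphB.
Qed.

Fact ASlift_monoid_morphism : monoid_morphism (ASlift bAS).
Proof.
split=> [|x y]; first by rewrite -(rmorph1 (ASpi pK g)) ASlift_pi rmorph1.
have [[q ->] [q' ->]] := (ASpi_surj x, ASpi_surj y).
by rewrite -rmorphM !ASlift_pi rmorphM.
Qed.

Fact ASlift_scalable : scalable (ASlift bAS).
Proof.
move=> a x; have [q ->] := ASpi_surj x.
by rewrite -linearZ !ASlift_pi mmapZ mulr_algl.
Qed.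

HB.instance Definition _ :=
  GRing.isZmodMorphism.Build A B (ASlift bAS) ASlift_zmod_morphism.
HB.instance Definition _ :=
  GRing.isMonoidMorphism.Build A B (ASlift bAS) ASlift_monoid_morphism.
HB.instance Definition _ :=
  GRing.isScalable.Build K A B *:%R (ASlift bAS) ASlift_scalable.

Lemma ASlift_var k : ASlift bAS (ASvar pK g k) = b k.
Proof. by rewrite /ASvar ASlift_pi mmapX mmap1U. Qed.

End Lift.

Lemma ASalg_finitely_presented : finitely_presented A.
Proof.
exists m, (ASpi pK g : {lrmorphism {mpoly K[m]} -> A}).
split=> [x|]; first by have [q ->] := ASpi_surj x; exists q.
by exists m, (ASpoly p g) => q; apply: ASpi_eq0.
Qed.

Lemma pexpr_eq_mod_sqz (B C : comAlgType K) (h : {lrmorphism B -> C}) :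
  (forall x y, h x = 0 -> h y = 0 -> x * y = 0) ->
  forall x y, h x = h y -> x ^+ p = y ^+ p.
Proof.
move=> h_sqz x y hxy; apply/eqP; rewrite -subr_eq0 -!(frob1 (pchar_alg pK B)).
have hxy0 : h (x - y) = 0 by rewrite rmorphB /= hxy subrr.
rewrite -rmorphB /= frob1 -(subnK (prime_gt1 (pcharf_prime pK))) addn2 !exprS.
by rewrite mulrA (h_sqz _ _ hxy0 hxy0) mul0r.
Qed.

(* Any lift y of a root x of W^p - W - a modulo a square-zero ideal has the
   same p-th power as the root y^p - a, which is therefore the only one. *)
Lemma ASalg_formally_etale : formally_etale A.
Proof.
move=> B C h h_surj h_sqz u.
have pexpr_h := pexpr_eq_mod_sqz h_sqz.
have /choice[b hb] : forall k, exists y, h y = u (ASvar pK g k).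
  by move=> k; apply: h_surj.
have uAS := lrmorph_AS_solution u ASvar_solution.
pose v k := b k ^+ p - (g k)%:A.
have hv k : h (v k) = u (ASvar pK g k).
  by rewrite rmorphB rmorphXn /= lrmorph_alg hb -(uAS k) opprB addrC subrK.
have vAS : AS_solution p g v.
  by move=> k; rewrite (pexpr_h (v k) (b k)) ?hv ?hb // opprB addrC subrK.
exists (ASlift vAS); split=> [|v' hv'].
  apply: (ASalg_hom_ext (h := h \o ASlift vAS)) => k /=.
  by rewrite ASlift_var hv.
apply: ASalg_hom_ext => k.
have v'AS := lrmorph_AS_solution v' ASvar_solution k.
rewrite /= ASlift_var /v -v'AS (pexpr_h (b k) (v' (ASvar pK g k))).
  by rewrite opprB addrC subrK.
by rewrite hb; apply/esym/hv'.
Qed.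

End UniversalProperty.

(** * Roots of Q and solutions of the Artin-Schreier equations *)

Section MapUnitMatrix.
Variables (R : comUnitRingType) (S : comNzRingType) (h : {rmorphism R -> S}).
Variables (n : nat) (X : 'M[R]_n).
Hypothesis X_unit : X \in unitmx.

Lemma map_unitmx_mulmxI k : injective (@mulmx S n n k (map_mx h X)).
Proof.
apply: (can_inj (g := mulmx (map_mx h (invmx X)))) => u.
by rewrite mulmxA -map_mxM mulVmx // map_mx1 mul1mx.
Qed.

Lemma map_mulKVmx k :
  cancel (@mulmx S n n k (map_mx h (invmx X))) (mulmx (map_mx h X)).
Proof. by move=> u; rewrite mulmxA -map_mxM mulmxV // map_mx1 mul1mx. Qed.

End MapUnitMatrix.

Section DualSystem.
Variables (K : fieldType) (p : nat) (pK : p \in [pchar K]).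
Variables (m : nat) (f : 'I_m.+1 -> K).
Variable B : comAlgType K.

Local Notation F := (frob pK).
Local Notation FB := (frob (pchar_alg pK B)).
Local Notation d := (dcoef p f).
Local Notation Delta := (moore p f).
Local Notation Q := (Qpoly p f).

Lemma frobZ k (a : K) (x : B) : FB k (a *: x) = F k a *: FB k x.
Proof. exact: exprZn. Qed.

Lemma frob_alg k (a : K) : FB k a%:A = (F k a)%:A.
Proof. by rewrite frobZ rmorph1. Qed.

Lemma frob_AS_root (a : K) (x : B) k : x ^+ p - x = a%:A ->
  FB k x = x + (\sum_(i < k) F i a)%:A.
Proof.
move=> xa; elim: k => [|k IHk].
  by rewrite big_ord0 scale0r addr0 frob0.
have xpE : x ^+ p = x + a%:A by rewrite -xa addrC subrK.
by rewrite frobSr xpE rmorphD /= IHk frob_alg big_ord_recr scalerDl addrA.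
Qed.

Lemma frob_sum_telescope (a : K) k (s := \sum_(i < k) F i a) :
  F 1 s - s = F k a - a.
Proof.
rewrite -[X in _ = _ - X](frob0 pK a) -(telescope_sumr (F^~ a) (leq0n k)).
rewrite sumrB !big_mkord rmorph_sum; congr (_ - _); apply: eq_bigr => i _.
by rewrite /= frob_comp.
Qed.

Lemma wdetE (w : 'I_m.+1 -> B) : wdet p f w = \sum_j d j *: w j.
Proof.
rewrite /wdet (expand_det_row _ ord0); apply: eq_bigr => j _.
rewrite !mxE /= mulrC -[RHS]mulr_algl; congr (_ * _).
rewrite -[RHS]/(in_alg B _) /dcoef /minor rmorphM rmorph_sign /= /cofactor /=.
rewrite add0n; congr (_ * _); rewrite -[RHS]/(in_alg B _) -moore_rmorph.
congr (\det _); apply/matrixP=> i k.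
by rewrite !mxE -[LHS]/(in_alg B _) rmorphXn.
Qed.

Local Notation D := (moore_mx p d).
Local Notation algmx X := (map_mx (in_alg B) X).

(* Solutions w_j of the Artin-Schreier equations enter this system through
   x_j = w_j^(p^m) and z = sum_j d_j w_j; the n of the theorem is [m.+1]. *)
Definition dual_system (z : B) (x : 'cV[B]_m.+1) : Prop :=
  algmx D *m x = \col_k FB k z.

Lemma dual_systemP z x :
  dual_system z x <-> forall k : 'I_m.+1, \sum_j F k (d j) *: x j 0 = FB k z.
Proof.
have DxE (k : 'I_m.+1) : (algmx D *m x) k 0 = \sum_j F k (d j) *: x j 0.
  by rewrite mxE; apply: eq_bigr => j _; rewrite !mxE mulr_algl.
split=> [/colP xz k|xz]; first by rewrite -DxE xz mxE.
by apply/colP=> k; rewrite DxE xz mxE.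
Qed.

Lemma AS_solution_dual_system (w : 'I_m.+1 -> B) : AS_solution p f w ->
  dual_system (\sum_j d j *: w j) (\col_j FB m (w j)).
Proof.
move=> wAS; apply/dual_systemP => k; have km : (k <= m)%N by rewrite -ltnS.
have pairing0 :
    (\sum_j F k (d j) * \sum_(i < m - k) F (k + i) (f j))%:A = 0 :> B.
  under eq_bigr do rewrite mulr_sumr.
  rewrite -[RHS](scale0r 1) exchange_big; congr (_ *: _).
  rewrite /= big1 // => i _; rewrite -/(dual_pairing pK f k (k + i)).
  by rewrite dual_pairing_eq0 // leq_addr /= ltn_add2l; have := ltn_ord i; lia.
rewrite rmorph_sum /= -[RHS]addr0 -[X in _ + X]pairing0 scaler_suml.
rewrite -big_split; apply: eq_bigr => j _; rewrite !mxE /= frobZ -scalerA.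
rewrite -scalerDr; congr (_ *: _).
have -> : FB m (w j) = FB k (FB (m - k) (w j)) by rewrite frob_comp subnKC.
rewrite (frob_AS_root _ (wAS j)) rmorphD /= frob_alg; congr (_ + _%:A).
by rewrite rmorph_sum /=; under [in RHS]eq_bigr do rewrite -frob_comp.
Qed.

Lemma horner_Qpoly : moore p f != 0 -> forall z : B, horner_alg z Q =
  \sum_(k < m.+2) qcoef p f k *: FB k z - (F m Delta)%:A.
Proof.
move=> f_indep z; rewrite (QpolyE pK) // rmorphB rmorph_sum /= horner_algC.
congr (_ - _); apply: eq_bigr => k _.
by rewrite linearZ /= rmorphXn /= horner_algX mulr_algl.
Qed.

Hypothesis f_indep : Delta != 0.

Lemma dual_system_exists z : exists x, dual_system z x.
Proof.
exists (algmx (invmx D) *m \col_k FB k z).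
by rewrite /dual_system (map_mulKVmx _ (moore_mx_dcoef_unit pK f_indep)).
Qed.

(* The next equation, k = m + 1, is not a consequence of the system: Q(z)
   measures by how much it fails. *)
Lemma horner_Qpoly_dual_system z x : dual_system z x -> horner_alg z Q =
  FB m.+1 z - \sum_j F m.+1 (d j) *: x j 0 - (F m Delta)%:A.
Proof.
move=> /dual_systemP xz; rewrite horner_Qpoly //; congr (_ - _).
rewrite big_ord_recr /= (qcoef_max pK) // scale1r addrC; congr (_ + _).
under eq_bigr do rewrite -xz scaler_sumr.
rewrite exchange_big -sumrN; apply: eq_bigr => j _ /=.
under eq_bigr do rewrite scalerA.
rewrite -scaler_suml -scaleNr; congr (_ *: _).
have := qcoef_dcoef pK f j; rewrite big_ord_recr /= (qcoef_max pK) //.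
by rewrite mul1r => /eqP; rewrite addr_eq0 => /eqP.
Qed.

Lemma frob_dual_system z x : dual_system z x ->
  algmx (map_mx (F 1) D)
    *m \col_j (FB 1 (x j 0) - x j 0 - (F m (f j))%:A) =
  horner_alg z Q *: delta_mx ord_max 0.
Proof.
move=> xz; have /dual_systemP xzE := xz.
apply/colP=> k; rewrite !mxE eqxx andbT.
have -> : \sum_j algmx (map_mx (F 1) D) k j
      * (\col_j (FB 1 (x j 0) - x j 0 - (F m (f j))%:A)) j 0 =
    FB k.+1 z - \sum_j F k.+1 (d j) *: x j 0 - (dual_pairing pK f k.+1 m)%:A.
  rewrite -(add1n k) -frob_comp -xzE rmorph_sum scaler_suml -!sumrB.
  apply: eq_bigr => j _; rewrite !mxE /= -(frobE pK k) frob_comp frobZ.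
  by rewrite frob_comp mulr_algl !scalerBr scalerA.
have [->|km] := eqVneq k ord_max.
  by rewrite dual_pairingS mulr1 -horner_Qpoly_dual_system.
have lt_km : (k.+1 < m.+1)%N.
  by rewrite ltn_neqAle ltn_ord andbT -val_eqE in km *.
rewrite (xzE (Ordinal lt_km)) subrr sub0r dual_pairing_eq0 ?scale0r ?oppr0.
  by rewrite mulr0.
by move: lt_km; lia.
Qed.

Lemma Qpoly_root_dual_system z x : dual_system z x ->
  horner_alg z Q = 0 <-> AS_solution p (F m \o f) (fun j => x j 0).
Proof.
move=> xz; have FDxz := frob_dual_system xz.
have FD_unit : map_mx (F 1) D \in unitmx.
  by rewrite map_unitmx (moore_mx_dcoef_unit pK).
split=> [Qz j|xAS].
  rewrite Qz scale0r -(mulmx0 _ (algmx (map_mx (F 1) D))) in FDxz.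
  have /colP/(_ j)/eqP := map_unitmx_mulmxI FD_unit FDxz.
  by rewrite !mxE subr_eq0 => /eqP.
have := congr1 (fun u : 'cV_m.+1 => u ord_max 0) FDxz.
rewrite [RHS]mxE [in RHS]mxE !eqxx mulr1 => <-; rewrite mxE big1 // => j _.
by rewrite [X in _ * X]mxE xAS subrr mulr0.
Qed.

Lemma AS_solution_Qpoly_root (w : 'I_m.+1 -> B) :
  AS_solution p f w -> horner_alg (\sum_j d j *: w j) Q = 0.
Proof.
move=> wAS; apply/(Qpoly_root_dual_system (AS_solution_dual_system wAS)) => j.
rewrite mxE -[_ ^+ p](frob1 (pchar_alg pK B)) frob_comp addnC -frob_comp.
by rewrite -rmorphB /= frob1 wAS frob_alg.
Qed.

Lemma Qpoly_root_AS_solution (z : B) : horner_alg z Q = 0 ->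
  exists2 w : 'I_m.+1 -> B, AS_solution p f w & z = \sum_j d j *: w j.
Proof.
have [x xz] := dual_system_exists z.
move=> /(Qpoly_root_dual_system xz) xAS.
exists (fun j => x j 0 - (\sum_(i < m) F i (f j))%:A) => [j|].
  rewrite -[X in X - _](frob1 (pchar_alg pK B)) rmorphB /= frob_alg frob1.
  rewrite opprD addrACA opprK; have := xAS j => /= ->.
  rewrite -[X in _ + X]opprK opprD opprK -scalerBl frob_sum_telescope.
  by rewrite scalerBl opprB addrC subrK.
move/dual_systemP/(_ ord0): xz; rewrite frob0 => <-.
under [RHS]eq_bigr do rewrite scalerBr scalerA.
rewrite sumrB -scaler_suml; under [X in _ - X *: _]eq_bigr do rewrite mulr_sumr.
rewrite exchange_big [X in _ - X *: _]big1 => [|i _].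
  by rewrite scale0r subr0; apply: eq_bigr => j _; rewrite frob0.
rewrite -[RHS](dual_pairing0_lt pK f (ltn_ord i)).
by apply: eq_bigr => j _; rewrite frob0.
Qed.

Lemma AS_solution_mooreE (w : 'I_m.+1 -> B) (z := \sum_j d j *: w j) i :
  AS_solution p f w ->
  w i = (moore p d)^-1 *: moore p (fun k => if k == i then z else (d k)%:A)
        - (\sum_(k < m) f i ^+ (p ^ k))%:A.
Proof.
move=> wAS; have w_sys := AS_solution_dual_system wAS.
suff -> : moore p (fun k => if k == i then z else (d k)%:A) =
    (moore p d)%:A * (w i + (\sum_(k < m) F k (f i))%:A).
  rewrite mulr_algl scalerA mulVf ?(moore_dcoef_neq0 pK) // scale1r.
  by rewrite addrK.
rewrite -(frob_AS_root m (wAS i)) -[_%:A]/(in_alg B _) -det_map_mx.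
have := cramer_rule (algmx D) (\col_j FB m (w j)) i; rewrite w_sys mxE => <-.
congr (\det _); apply/matrixP=> k j; rewrite !mxE.
by case: ifP => // _; rewrite -[LHS]/(FB k _) frob_alg.
Qed.

Lemma AS_solution_inj (w w' : 'I_m.+1 -> B) :
  AS_solution p f w -> AS_solution p f w' ->
  \sum_j d j *: w j = \sum_j d j *: w' j -> w =1 w'.
Proof.
by move=> wAS w'AS ww' i; rewrite AS_solution_mooreE // ww' -AS_solution_mooreE.
Qed.

End DualSystem.

(** * The primitive element *)

Lemma horner_alg_polyX (K : comNzRingType) (q : {poly K}) : horner_alg 'X q = q.
Proof.
elim/poly_ind: q => [|q a IHq]; first by rewrite rmorph0.
by rewrite rmorphD rmorphM /= horner_algX horner_algC IHq alg_polyC.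
Qed.

Section QuotientPolynomial.
Variables (K : fieldType) (Q : {poly K}).

Lemma horner_alg_qpolyX (q : {poly K}) : horner_alg 'qX q = in_qpoly Q q.
Proof.
rewrite -{2}(horner_alg_polyX q).
exact/esym/(lrmorph_horner_alg (in_qpoly Q : {lrmorphism {poly K} -> _})).
Qed.

Lemma qpoly_hornerE (x : {poly %/ Q}) : x = horner_alg 'qX (x : {poly K}).
Proof.
rewrite horner_alg_qpolyX; apply/val_inj/esym.
exact: in_qpoly_small (size_mk_monic x).
Qed.

Variables (B : comAlgType K) (b : B).

Definition qpoly_lift (bQ : horner_alg b (mk_monic Q) = 0) (x : {poly %/ Q}) :
    B :=
  horner_alg b (x : {poly K}).

Variable bQ : horner_alg b (mk_monic Q) = 0.

Lemma qpoly_lift_in_qpoly q : qpoly_lift bQ (in_qpoly Q q) = horner_alg b q.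
Proof.
rewrite /qpoly_lift /= -Pdiv.IdomainMonic.modpE ?monic_mk_monic //.
rewrite [in RHS](divp_eq q (mk_monic Q)) rmorphD rmorphM /=.
by rewrite [X in _ * X]bQ mulr0 add0r.
Qed.

Fact qpoly_lift_zmod_morphism : zmod_morphism (qpoly_lift bQ).
Proof. by move=> x y; rewrite /qpoly_lift -rmorphB. Qed.

Fact qpoly_lift_monoid_morphism : monoid_morphism (qpoly_lift bQ).
Proof.
split=> [|x y]; first by rewrite /qpoly_lift -[RHS](rmorph1 (horner_alg b)).
by rewrite [x * y]/(in_qpoly _ _) qpoly_lift_in_qpoly rmorphM.
Qed.

Fact qpoly_lift_scalable : scalable (qpoly_lift bQ).
Proof.
move=> a x; rewrite -[LHS]/(horner_alg b (a *: (x : {poly K}))) linearZ /=.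
by rewrite mulr_algl.
Qed.

HB.instance Definition _ := GRing.isZmodMorphism.Build {poly %/ Q} B
  (qpoly_lift bQ) qpoly_lift_zmod_morphism.
HB.instance Definition _ := GRing.isMonoidMorphism.Build {poly %/ Q} B
  (qpoly_lift bQ) qpoly_lift_monoid_morphism.
HB.instance Definition _ := GRing.isScalable.Build K {poly %/ Q} B *:%R
  (qpoly_lift bQ) qpoly_lift_scalable.

End QuotientPolynomial.

Section PrimitiveElement.
Variables (K : fieldType) (p : nat) (pK : p \in [pchar K]).
Variables (m : nat) (f : 'I_m.+1 -> K).
Hypothesis f_indep : moore p f != 0.

Local Notation d := (dcoef p f).
Local Notation Q := (Qpoly p f).
Local Notation A := (ASalg pK f).
Local Notation w := (wdet p f (ASvar pK f)).

Lemma mk_monic_Qpoly : mk_monic Q = Q.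
Proof. by rewrite /mk_monic (size_Qpoly_gt1 pK) ?(monic_Qpoly pK). Qed.

Lemma wdet_root : horner_alg w Q = 0.
Proof. by rewrite wdetE; apply/AS_solution_Qpoly_root/ASvar_solution. Qed.

Lemma qpolyX_root : horner_alg ('qX : {poly %/ Q}) Q = 0.
Proof.
rewrite horner_alg_qpolyX; apply/val_inj; rewrite /= mk_monic_Qpoly.
by rewrite Pdiv.RingMonic.rmodpp ?(monic_Qpoly pK).
Qed.

(* Both algebras represent the functor of solutions of the Artin-Schreier
   equations, by [AS_solution_Qpoly_root] and [Qpoly_root_AS_solution]. *)
Lemma qpoly_ASalg_iso : exists theta : {lrmorphism {poly %/ Q} -> A},
  bijective theta /\ theta 'qX = w.
Proof.
have w_root : horner_alg w (mk_monic Q) = 0 by rewrite mk_monic_Qpoly wdet_root.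
pose theta : {lrmorphism {poly %/ Q} -> A} := qpoly_lift w_root.
have thetaX : theta 'qX = w by rewrite /= qpoly_lift_in_qpoly horner_algX.
exists theta; split=> //.
have [b bAS qX_b] := Qpoly_root_AS_solution pK f_indep qpolyX_root.
pose eta : {lrmorphism A -> {poly %/ Q}} := ASlift bAS.
have eta_w : eta w = 'qX.
  rewrite wdetE linear_sum qX_b; apply: eq_bigr => j _.
  by rewrite linearZ /= ASlift_var.
have etaK : cancel eta theta.
  apply: (ASalg_hom_ext (h := theta \o eta) (h' := idfun)).
  apply: (AS_solution_inj pK f_indep _ (ASvar_solution pK f)).
    by move=> j; rewrite /= ASlift_var; apply: (lrmorph_AS_solution theta bAS).
  rewrite -[RHS]wdetE -thetaX qX_b linear_sum; apply: eq_bigr => j _.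
  by rewrite linearZ /= ASlift_var.
exists eta => // x; rewrite -[theta x]/(horner_alg w (x : {poly K})).
by rewrite lrmorph_horner_alg eta_w -qpoly_hornerE.
Qed.

Lemma ASalg_horner (x : A) : exists q : {poly K}, x = horner_alg w q.
Proof.
have [theta [[eta _ etaK] <-]] := qpoly_ASalg_iso; exists (eta x : {poly K}).
by rewrite -lrmorph_horner_alg -qpoly_hornerE etaK.
Qed.

Lemma ASvar_wdetE i :
  ASvar pK f i =
  (moore p d)^-1 *: moore p (fun k => if k == i then w else (d k)%:A)
  - (\sum_(k < m) f i ^+ (p ^ k))%:A.
Proof. by rewrite wdetE; apply/AS_solution_mooreE/ASvar_solution. Qed.

End PrimitiveElement.

(** * Scalars in the prime field *)

Section PrimeFieldMultiples.
Variables (p : nat) (p_pr : prime p) (V : zmodType) (v : V).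
Hypothesis v_tors : v *+ p = 0.

Lemma mulrn_modn n : v *+ (n %% p)%N = v *+ n.
Proof.
by rewrite [in RHS](divn_eq n p) mulrnDr mulnC mulrnA v_tors mul0rn add0r.
Qed.

Lemma mulrn_FpD (a b : 'F_p) : v *+ (a + b)%R = v *+ a + v *+ b.
Proof.
have -> : (a + b)%R = ((a + b) %% p)%N :> nat.
  exact: (congr1 (modn (a + b)%N) (Fp_cast p_pr)).
by rewrite mulrn_modn mulrnDr.
Qed.

Lemma mulrn_FpB (a b : 'F_p) : v *+ (a - b)%R = v *+ a - v *+ b.
Proof. by apply/eqP; rewrite -subr_eq opprK -mulrn_FpD subrK. Qed.

End PrimeFieldMultiples.

Lemma mulrn_pchar (R : nzRingType) p (pR : p \in [pchar R]) (x : R) :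
  x *+ p = 0.
Proof. by rewrite -mulr_natr (pcharf0 pR) mulr0. Qed.

Section PrimeFieldEmbedding.
Variables (R : nzRingType) (p : nat).

Definition Fp_embed (pR : p \in [pchar R]) (c : 'F_p) : R := (c : nat)%:R.

Variable pR : p \in [pchar R].
Let p_pr := pcharf_prime pR.

Fact Fp_embed_zmod_morphism : zmod_morphism (Fp_embed pR).
Proof. by move=> a b; rewrite -(mulrn_FpB p_pr (mulrn_pchar pR 1)). Qed.

Fact Fp_embed_monoid_morphism : monoid_morphism (Fp_embed pR).
Proof.
split=> [|a b]; rewrite /Fp_embed; first by [].
rewrite -natrM -(GRing.natr_mod_pchar pR (a * b)%N).
by congr (_%:R); exact: (congr1 (modn (a * b)%N) (Fp_cast p_pr)).
Qed.

HB.instance Definition _ :=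
  GRing.isZmodMorphism.Build 'F_p R (Fp_embed pR) Fp_embed_zmod_morphism.
HB.instance Definition _ :=
  GRing.isMonoidMorphism.Build 'F_p R (Fp_embed pR) Fp_embed_monoid_morphism.

Lemma mulrn_Fp_embed (x : R) (c : 'F_p) : x *+ c = x * Fp_embed pR c.
Proof. by rewrite mulr_natr. Qed.

End PrimeFieldEmbedding.

Lemma Fp_embed_alg (K : fieldType) p (pK : p \in [pchar K]) (B : comAlgType K)
    (c : 'F_p) :
  (Fp_embed pK c)%:A = Fp_embed (pchar_alg pK B) c.
Proof. exact: (rmorph_nat (in_alg B)). Qed.

Lemma lrmorph_Fp_embed (K : fieldType) p (pK : p \in [pchar K])
    (B C : comAlgType K) (h : {lrmorphism B -> C}) (c : 'F_p) :
  h (Fp_embed (pchar_alg pK B) c) = Fp_embed (pchar_alg pK C) c.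
Proof. exact: rmorph_nat. Qed.

Lemma Frobenius_fixed (L : fieldType) p (pL : p \in [pchar L]) (x : L) :
  x ^+ p = x -> exists c : 'F_p, x = Fp_embed pL c.
Proof.
move=> xp; have p_pr := pcharf_prime pL.
have :=
  congr1 (fun q => (map_poly (Fp_embed pL) q).[x]) (finField_genPoly 'F_p).
rewrite card_Fp // rmorphB rmorph_prod /= map_polyXn map_polyX !hornerE.
rewrite xp subrr horner_prod => /esym/eqP/prodf_eq0[c _].
by rewrite map_polyXsubC hornerXsubC subr_eq0 => /eqP->; exists c.
Qed.

(** * The space V and its bases *)

Section IndependenceModuloImage.
Variables (K : fieldType) (p r : nat) (g : 'I_r -> K).

Definition AS_free : Prop := forall (c : 'I_r -> 'F_p) (y : K),
  \sum_k g k *+ c k = y ^+ p - y -> forall k, c k = 0.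

Definition AS_spans n (f : 'I_n -> K) : Prop :=
  forall j, exists (c : 'I_r -> 'F_p) (y : K),
    f j = \sum_k g k *+ c k + (y ^+ p - y).

End IndependenceModuloImage.

Section Cokernel.
Variables (K : fieldType) (p : nat) (pK : p \in [pchar K]).
Local Notation cls := (AScls pK).
Let p_pr : prime p := pcharf_prime pK.

Fact AScls_zmod_morphism : zmod_morphism cls.
Proof. by move=> x y; rewrite /AScls raddfB. Qed.

HB.instance Definition _ :=
  GRing.isZmodMorphism.Build K (AScoker pK) cls AScls_zmod_morphism.

Lemma AScls_eq0 x : cls x = 0 <-> exists y, x = y ^+ p - y.
Proof.
rewrite -(raddf0 cls) /AScls; split=> [/eqP|x_image].
  by rewrite -Quotient.idealrBE subr0 => /asboolP.
by apply/eqP; rewrite -Quotient.idealrBE subr0; apply/asboolP.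
Qed.

Lemma AScoker_mulrn (v : AScoker pK) : v *+ p = 0.
Proof.
have -> : v = cls (repr v) by rewrite /AScls reprK.
by rewrite -raddfMn /= mulrn_pchar ?raddf0.
Qed.

Section Basis.
Variables (n : nat) (f : 'I_n -> K).

Lemma ASspace0 : ASspace f (0 : AScoker pK).
Proof.
exists (fun _ => 0), 0; apply/esym/AScls_eq0; exists 0.
by rewrite big1 ?add0r // => i _; rewrite mulr0n.
Qed.

Lemma ASspaceD (u v : AScoker pK) :
  ASspace f u -> ASspace f v -> ASspace f (u + v).
Proof.
case=> [a [y ->]] [b [z ->]]; exists (fun i => a i + b i), (y + z).
rewrite -raddfD; congr cls; rewrite addrACA; congr (_ + _).
  rewrite -big_split; apply: eq_bigr => i _ /=.
  by rewrite (mulrn_FpD p_pr (mulrn_pchar pK _)).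
have := rmorphD (frob pK 1) y z; rewrite /= !frob1 => ->.
by rewrite opprD addrACA.
Qed.

Lemma ASspaceMn (v : AScoker pK) k : ASspace f v -> ASspace f (v *+ k).
Proof.
move=> Sv; elim: k => [|k IHk]; first by rewrite mulr0n; apply: ASspace0.
by rewrite mulrS; apply: ASspaceD.
Qed.

Lemma ASspace_gen j : ASspace f (cls (f j)).
Proof.
exists (fun i => (i == j)%:R), 0; congr cls.
rewrite expr0n (gtn_eqF (prime_gt0 p_pr)) subrr addr0.
by rewrite (bigD1 j) //= eqxx big1 ?addr0 // => i /negPf ->.
Qed.

Lemma ASbasis_inj m (v : 'I_m -> AScoker pK) : ASbasis f v ->
  injective (fun c : {ffun 'I_m -> 'F_p} => \sum_k v k *+ c k).
Proof.
case=> _ v_free _ c c' cc'; apply/ffunP=> k; apply/eqP; rewrite -subr_eq0.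
apply/eqP; apply: (v_free (fun k => c k - c' k)).
under eq_bigr do rewrite (mulrn_FpB p_pr (AScoker_mulrn _)).
by rewrite sumrB cc' subrr.
Qed.

Lemma ASbasis_leq m m' (v : 'I_m -> AScoker pK) (v' : 'I_m' -> AScoker pK) :
  ASbasis f v -> ASbasis f v' -> (m <= m')%N.
Proof.
move=> v_basis [_ _ v'_span]; have [Sv _ _] := v_basis.
have /choice[h hE] : forall c : {ffun 'I_m -> 'F_p},
    exists c' : {ffun 'I_m' -> 'F_p}, \sum_k v k *+ c k = \sum_k v' k *+ c' k.
  move=> c; have [|c' ->] := v'_span (\sum_k v k *+ c k).
    apply: (big_ind (fun u : AScoker pK => ASspace f u)) => [|u u'|k _].
    - exact: ASspace0.
    - exact: ASspaceD.
    - exact: ASspaceMn.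
  by exists (finfun c'); apply: eq_bigr => k _; rewrite ffunE.
have h_inj : injective h.
  by move=> c c' cc'; apply: (ASbasis_inj v_basis); rewrite !hE cc'.
have := leq_card h h_inj; rewrite !card_ffun !card_ord Fp_cast //.
by rewrite leq_exp2l ?prime_gt1.
Qed.

Lemma ASdim_unique r m (v : 'I_m -> AScoker pK) :
  ASdim pK f r -> ASbasis f v -> r = m.
Proof.
case=> u u_basis v_basis; apply/eqP; rewrite eqn_leq.
by rewrite (ASbasis_leq u_basis v_basis) (ASbasis_leq v_basis u_basis).
Qed.

Variables (m : nat) (e : 'I_m -> 'I_n).
Hypothesis e_basis : ASbasis f (fun k => cls (f (e k))).

Lemma ASbasis_free : AS_free p (fun k => f (e k)).
Proof.
have [_ e_free _] := e_basis => c y cy; apply: e_free.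
transitivity (cls (\sum_k f (e k) *+ c k)); last by apply/AScls_eq0; exists y.
by rewrite raddf_sum; apply: eq_bigr => k _; rewrite raddfMn.
Qed.

Lemma ASbasis_spans : AS_spans p (fun k => f (e k)) f.
Proof.
have [_ _ e_span] := e_basis => j; have [c cE] := e_span _ (ASspace_gen j).
have /AScls_eq0[y yE] : cls (f j - \sum_k f (e k) *+ c k) = 0.
  rewrite raddfB /= cE raddf_sum -sumrB big1 // => k _.
  by rewrite raddfMn subrr.
by exists c, y; rewrite -yE addrC subrK.
Qed.

End Basis.
End Cokernel.

(** * Translates and combinations of solutions *)

Section ShiftSolution.
Variables (K : fieldType) (p : nat) (pK : p \in [pchar K]) (n : nat).

Lemma AS_solution_shift (B : comAlgType K) (g : 'I_n -> K) (b : 'I_n -> B)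
    (c : 'I_n -> 'F_p) :
  AS_solution p g b ->
  AS_solution p g (fun k => b k + Fp_embed (pchar_alg pK B) (c k)).
Proof.
move=> bAS k; rewrite -(frob1 (pchar_alg pK B)) rmorphD /= !frob1 -[RHS]bAS.
rewrite -[X in _ + X - _](pFrobenius_autE (pchar_alg pK B)).
by rewrite pFrobenius_aut_nat opprD addrACA subrr addr0.
Qed.

Lemma AS_lincomb (B : comAlgType K) (g : 'I_n -> K) (b : 'I_n -> B)
    (c : 'I_n -> nat) (y : K) (x := \sum_k b k *+ c k + y%:A) :
  AS_solution p g b ->
  x ^+ p - x = (\sum_k g k *+ c k + (y ^+ p - y))%:A.
Proof.
move=> bAS; rewrite -(frob1 (pchar_alg pK B)) rmorphD rmorph_sum opprD addrACA.
rewrite scalerDl; congr (_ + _); last by rewrite /= frob_alg scalerBl.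
rewrite -sumrB scaler_suml; apply: eq_bigr => k _.
by rewrite raddfMn /= -mulrnBl frob1 bAS scalerMnl.
Qed.

Lemma AS_root_translate (L : fieldExtType K) (x y : L) (a : K) :
  x ^+ p - x = a%:A -> y ^+ p - y = a%:A ->
  exists c : 'F_p, x = y + Fp_embed (pchar_alg pK L) c.
Proof.
move=> xa ya; have [|c xy] := @Frobenius_fixed _ _ (pchar_alg pK L) (x - y).
  rewrite -(frob1 (pchar_alg pK L)) rmorphB /= !frob1.
  rewrite -[x ^+ p](subrK x) -[y ^+ p](subrK y) xa ya.
  by rewrite opprD addrACA subrr add0r.
by exists c; rewrite -xy addrC subrK.
Qed.

End ShiftSolution.

(** * The splitting field of Q *)

Lemma simple_extension (K : fieldType) (Kalg : closedFieldType)
    (iota : {rmorphism K -> Kalg}) (z : Kalg) : algebraicOver iota z ->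
  exists (L : fieldExtType K) (j : {rmorphism L -> Kalg}) (x : L),
    [/\ forall a : K, j a%:A = iota a, j x = z
      & generates (fun _ : unit => x)].
Proof.
case=> q0 q0_neq0 q0z.
pose annihilates n :=
  `[< exists q, [/\ q != 0, root (map_poly iota q) z & size q = n] >].
have ex_annihilates : exists n, annihilates n.
  by exists (size q0); apply/asboolP; exists q0.
case: (ex_minnP ex_annihilates) => n /asboolP[q [q_neq0 qz size_q]] q_min.
have q_irr : irreducible_poly q.
  apply/(subfx_irreducibleP qz q_neq0) => q' q'z q'_neq0; rewrite size_q.
  by apply: q_min; apply/asboolP; exists q'.
exists (SubFieldExtType qz q_irr), (@subfx_inj _ _ iota z q).
exists (subfx_root iota z q); split.
- exact: subfx_inj_base.
- exact: subfx_inj_root.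
- move=> S subS Sx y; have [q' ->] := subfxEroot qz q_neq0 y.
  exact: (subalgebra_horner subS _ (Sx tt)).
Qed.

Section RootsOfQ.
Variables (K : fieldType) (p : nat) (pK : p \in [pchar K]).
Variables (m : nat) (f : 'I_m.+1 -> K).
Hypothesis f_indep : moore p f != 0.
Variables (L : fieldExtType K) (alpha : 'I_m.+1 -> L).
Hypothesis alphaAS : AS_solution p f alpha.

Local Notation d := (dcoef p f).
Local Notation Q := (Qpoly p f).
Local Notation ffT := {ffun 'I_m.+1 -> 'F_p}.

Definition Qroot (c : ffT) : L :=
  \sum_j d j *: (alpha j + Fp_embed (pchar_alg pK L) (c j)).

Lemma Qroot_root c : horner_alg (Qroot c) Q = 0.
Proof.
exact: (AS_solution_Qpoly_root pK f_indep (AS_solution_shift pK c alphaAS)).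
Qed.

Lemma Qroot_inj : injective Qroot.
Proof.
move=> c c' cc'; apply/ffunP=> j.
apply: (fmorph_inj (Fp_embed (pchar_alg pK L))); apply: (addrI (alpha j)).
exact: (AS_solution_inj pK f_indep (AS_solution_shift pK c alphaAS)
  (AS_solution_shift pK c' alphaAS) cc').
Qed.

Lemma map_Qpoly_prod_XsubC :
  map_poly (in_alg L) Q = \prod_(x <- codom Qroot) ('X - x%:P).
Proof.
rewrite (@all_roots_prod_XsubC _ (map_poly (in_alg L) Q) (codom Qroot)).
- by rewrite lead_coef_map (monicP (monic_Qpoly pK f_indep)) rmorph1 scale1r.
- rewrite size_map_poly (size_Qpoly pK) // size_codom card_ffun.
  by rewrite card_Fp ?(pcharf_prime pK) // card_ord.
- by apply/allP=> _ /codomP[c ->]; rewrite rootE; apply/eqP/Qroot_root.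
- by rewrite uniq_rootsE; apply/injectiveP/Qroot_inj.
Qed.

Lemma separable_map_Qpoly : separable_poly (map_poly (in_alg L) Q).
Proof.
rewrite map_Qpoly_prod_XsubC separable_prod_XsubC.
exact/injectiveP/Qroot_inj.
Qed.

Lemma map_Qpoly_polyOver1 : map_poly (in_alg L) Q \is a polyOver 1%VS.
Proof. by apply/polyOverP=> i; rewrite coef_map /= memvZ ?rpred1. Qed.

Lemma Qpoly_splittingFor : generates (fun _ : unit => \sum_j d j *: alpha j) ->
  splittingFieldFor 1%VS (map_poly (in_alg L) Q) {:L}.
Proof.
move=> alpha_gen; exists (codom Qroot).
  by rewrite map_Qpoly_prod_XsubC eqpxx.
apply/eqP; rewrite eqEsubv subvf; apply/subvP=> y _; move: y.
apply: (alpha_gen (fun y => y \in <<1 & codom Qroot>>%VS)) => [|_].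
  by split=> [a|x y|x y]; [rewrite memvZ ?rpred1|apply: rpredD|apply: rpredM].
apply/seqv_sub_adjoin/codomP; exists [ffun=> 0].
by apply: eq_bigr => j _; rewrite ffunE rmorph0 addr0.
Qed.

End RootsOfQ.

Lemma AS_splitting_field (K : fieldType) (p : nat) (pK : p \in [pchar K])
    (Kalg : closedFieldType) (iota : {rmorphism K -> Kalg})
    (m : nat) (f : 'I_m.+1 -> K) :
  (forall x : Kalg, algebraicOver iota x) -> moore p f != 0 ->
  exists (L : splittingFieldType K) (j : {rmorphism L -> Kalg})
         (alpha : 'I_m.+1 -> L),
    [/\ forall a : K, j a%:A = iota a, AS_solution p f alpha, generates alpha
      & galois 1%VS {:L}].
Proof.
move=> Kalg_algebraic f_indep.
have [z Qz] : exists z, root (map_poly iota (Qpoly p f)) z.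
  apply/closed_rootP; rewrite size_map_poly.
  by rewrite neq_ltn (size_Qpoly_gt1 pK) ?orbT.
have [L [j [x [jK jx x_gen]]]] := simple_extension (Kalg_algebraic z).
have Qx : horner_alg x (Qpoly p f) = 0.
  apply: (fmorph_inj j); rewrite rmorph0 -[horner_alg _ _]/((map_poly _ _).[_]).
  by rewrite -horner_map -map_poly_comp jx (eq_map_poly jK); apply/eqP.
have [alpha alphaAS xE] := Qpoly_root_AS_solution pK f_indep Qx; subst x.
have Q_split := Qpoly_splittingFor pK f_indep alphaAS x_gen.
have Q_over1 := map_Qpoly_polyOver1 p f L.
have L_split : splitting_field_axiom L.
  by exists (map_poly (in_alg L) (Qpoly p f)).
pose L_isSplit := FieldExt_isSplittingField.Build K L L_split.
exists (HB.pack_for (splittingFieldType K) L L_isSplit), j, alpha.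
split=> // [S subS S_alpha|].
  by apply: x_gen => // _; apply: subalgebra_sum => // i; apply: subalgebraZ.
apply/splitting_galoisField; exists (map_poly (in_alg L) (Qpoly p f)).
by split=> //; apply: separable_map_Qpoly alphaAS.
Qed.

(** * The Galois group of an Artin-Schreier extension *)

Lemma Gal_fullE (K : fieldType) (L : splittingFieldType K) :
  'Gal({:L} / 1%AS)%g = [set: gal_of {:L}].
Proof.
apply/setP=> s; rewrite inE gal_kHom ?sub1v //.
by apply/kAHomP=> _ /vlineP[a ->]; rewrite lrmorph_alg.
Qed.

Section ArtinSchreierGalois.
Variables (K : fieldType) (p : nat) (pK : p \in [pchar K]).
Variables (L : splittingFieldType K) (galL : galois 1%VS {:L}).
Variables (r : nat) (g : 'I_r -> K) (beta : 'I_r -> L).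
Hypothesis betaAS : AS_solution p g beta.
Hypothesis beta_gen : generates beta.
Hypothesis g_free : AS_free p g.

Local Notation gT := (gal_of {:L}).
Local Notation Fp_in := (Fp_embed (pchar_alg pK L)).

Lemma gal_translate (s : gT) k : exists c : 'F_p, s (beta k) = beta k + Fp_in c.
Proof. exact/AS_root_translate/betaAS/(lrmorph_AS_solution s betaAS). Qed.

Definition gal_shift (s : gT) : 'rV['F_p]_r :=
  \row_k odflt 0 [pick c | s (beta k) == beta k + Fp_in c].

Lemma gal_shiftE (s : gT) k : s (beta k) = beta k + Fp_in (gal_shift s 0 k).
Proof.
rewrite mxE; case: pickP => [c /eqP //|no_c].
by have [c /eqP] := gal_translate s k; rewrite no_c.
Qed.

Lemma gal_shiftM : {in [set: gT] &, {morph gal_shift : s t / (s * t)%g}}.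
Proof.
move=> s t _ _; apply/rowP=> k; rewrite [RHS]mxE.
apply: (fmorph_inj Fp_in); apply: (addrI (beta k)); rewrite -gal_shiftE.
rewrite galM ?memvf // gal_shiftE rmorphD /= lrmorph_Fp_embed gal_shiftE.
by rewrite rmorphD /= addrAC addrA.
Qed.

Canonical gal_shift_morphism := Morphism gal_shiftM.

Lemma gal_shift_inj : injective gal_shift.
Proof.
move=> s t st; apply/eqP/gal_eqP=> y _; move: y.
apply: (generates_hom_ext (h := s) (h' := t) beta_gen) => k.
by rewrite /= !gal_shiftE st.
Qed.

(* If all the vectors of the automorphisms are orthogonal to v, then
   sum_k v_k beta_k is fixed by the Galois group, hence lies in K. *)
Lemma gal_shift_nondegenerate (v : 'rV['F_p]_r) :
  (forall s, \sum_k v 0 k * gal_shift s 0 k = 0) -> v = 0.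
Proof.
move=> v0; pose x := \sum_k beta k *+ v 0 k.
have : x \in fixedField 'Gal({:L} / 1%AS)%g.
  apply/fixedFieldP; rewrite ?memvf // => s _.
  rewrite rmorph_sum /=; apply/eqP; rewrite -subr_eq0 -sumrB; apply/eqP.
  rewrite -[RHS](rmorph0 Fp_in) -(v0 s) [RHS]rmorph_sum; apply: eq_bigr => k _.
  rewrite raddfMn /= gal_shiftE -mulrnBl addrC addKr.
  by rewrite (mulrn_Fp_embed (pchar_alg pK L)) mulrC [RHS]rmorphM.
rewrite (galois_fixedField galL) => /vlineP[a xa].
apply/rowP=> k; rewrite mxE; apply: (@g_free (fun k => v 0 k) a).
apply: (fmorph_inj (in_alg L)).
have := AS_lincomb pK (fun k => v 0 k) 0 betaAS.
rewrite -/x scale0r addr0 expr0n gtn_eqF ?prime_gt0 ?(pcharf_prime pK) //.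
rewrite subrr addr0 /= => <-.
by rewrite xa scalerBl -[_%:A ^+ _](rmorphXn (in_alg L)).
Qed.

Lemma gal_shift_surj v : exists s, gal_shift s = v.
Proof.
pose M := \matrix_(i < #|{: gT}|) gal_shift (enum_val i).
have M_full : row_full M.
  rewrite /row_full -mxrank_tr -/(row_free M^T) -kermx_eq0; apply/negPn/negP.
  case/rowV0Pn=> u /sub_kermxP uM /negP[]; apply/eqP.
  apply: gal_shift_nondegenerate => s.
  have /rowP/(_ (enum_rank s)) := uM; rewrite [RHS]mxE => uMs.
  rewrite -[RHS]uMs mxE; apply: eq_bigr => k _.
  by rewrite [in RHS]mxE [in RHS]mxE enum_rankK.
have /submxP[D ->] : (v <= M)%MS by apply: submx_full.
rewrite mulmx_sum_row; elim/big_ind: _ => [|_ _ [s <-] [t <-]|i _].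
- by exists 1%g; rewrite (morph1 gal_shift_morphism).
- by exists (s * t)%g; rewrite gal_shiftM ?inE.
- rewrite rowK; exists (enum_val i ^+ (D 0 i : nat))%g.
  rewrite (morphX gal_shift_morphism) ?inE //=.
  by rewrite -[D 0 i in RHS]natr_Zp scaler_nat.
Qed.

Lemma Gal_isog : 'Gal({:L} / 1%VS)%g \isog [set: 'rV['F_p]_r].
Proof.
rewrite Gal_fullE; apply/isogP; exists gal_shift_morphism.
  by apply/injmP=> s t _ _; apply: gal_shift_inj.
apply/setP=> v; rewrite !inE; have [s <-] := gal_shift_surj v.
by rewrite mem_morphim ?inE.
Qed.

End ArtinSchreierGalois.

(** * Points of the Artin-Schreier algebra *)

Section Points.
Variables (K : fieldType) (p : nat) (pK : p \in [pchar K]).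
Variables (n : nat) (f : 'I_n -> K) (L : fieldExtType K) (alpha : 'I_n -> L).
Hypothesis alphaAS : AS_solution p f alpha.

Local Notation A := (ASalg pK f).
Local Notation ffT := {ffun 'I_n -> 'F_p}.
Local Notation Fp_in := (Fp_embed (pchar_alg pK L)).

Definition point (c : ffT) : A -> L :=
  ASlift (pK := pK) (AS_solution_shift pK c alphaAS).

HB.instance Definition _ c := GRing.LRMorphism.on (point c).

Lemma point_var c k : point c (ASvar pK f k) = alpha k + Fp_in (c k).
Proof. exact: ASlift_var. Qed.

Lemma lrmorph_point (h : {lrmorphism A -> L}) : exists c, h =1 point c.
Proof.
have /choice[c hc] : forall k, exists c : 'F_p,
    h (ASvar pK f k) = alpha k + Fp_in c.
  move=> k; apply/AS_root_translate/alphaAS.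
  exact: (lrmorph_AS_solution h (ASvar_solution pK f)).
exists (finfun c); apply: (ASalg_hom_ext (h' := point (finfun c))) => k.
by rewrite /= point_var ffunE.
Qed.

End Points.

Section PointsSeparate.
Variables (K : fieldType) (p : nat) (pK : p \in [pchar K]).
Variables (m : nat) (f : 'I_m.+1 -> K).
Hypothesis f_indep : moore p f != 0.
Variables (L : fieldExtType K) (alpha : 'I_m.+1 -> L).
Hypothesis alphaAS : AS_solution p f alpha.

Lemma point_wdet c : point alphaAS c (wdet p f (ASvar pK f)) =
  Qroot pK f alpha c.
Proof.
rewrite wdetE linear_sum; apply: eq_bigr => j _.
by rewrite linearZ /= point_var.
Qed.

Lemma points_separate (x : ASalg pK f) :
  (forall c, point alphaAS c x = 0) -> x = 0.
Proof.
have [q ->] := ASalg_horner f_indep x => q0.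
suff /dvdpP[q' ->] : Qpoly p f %| q by rewrite rmorphM /= wdet_root // mulr0.
rewrite -(dvdp_map (in_alg L)) (map_Qpoly_prod_XsubC pK f_indep alphaAS).
apply: uniq_roots_dvdp; last first.
  by rewrite uniq_rootsE; apply/injectiveP/Qroot_inj.
apply/allP=> _ /codomP[c ->]; rewrite rootE -point_wdet; apply/eqP.
by have := q0 c; rewrite lrmorph_horner_alg.
Qed.

End PointsSeparate.

(** * Decomposition of the Artin-Schreier algebra *)

Lemma inj_surj_bij (X Y : Type) (h : X -> Y) :
  injective h -> (forall y, exists x, y = h x) -> bijective h.
Proof.
move=> h_inj /choice[g gE].
by exists g => x; [apply: h_inj; rewrite -gE|rewrite -gE].
Qed.

Section ProductMap.
Variables (K : fieldType) (B : comAlgType K) (L : fieldExtType K).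
Variables (I : finType) (h : I -> {lrmorphism B -> L}).

Definition prodmap (x : B) : {ffun I -> L} := [ffun i => h i x].

Fact prodmap_zmod_morphism : zmod_morphism prodmap.
Proof. by move=> x y; apply/ffunP=> i; rewrite !ffunE rmorphB. Qed.

Fact prodmap_monoid_morphism : monoid_morphism prodmap.
Proof.
by split=> [|x y]; apply/ffunP=> i; rewrite !ffunE ?rmorph1 ?rmorphM.
Qed.

Fact prodmap_scalable : scalable prodmap.
Proof. by move=> a x; apply/ffunP=> i; rewrite !ffunE linearZ. Qed.

HB.instance Definition _ := GRing.isZmodMorphism.Build B {ffun I -> L}
  prodmap prodmap_zmod_morphism.
HB.instance Definition _ := GRing.isMonoidMorphism.Build B {ffun I -> L}
  prodmap prodmap_monoid_morphism.
HB.instance Definition _ := GRing.isScalable.Build K B {ffun I -> L} *:%R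
  prodmap prodmap_scalable.

Lemma prodmap_inj : (forall x, (forall i, h i x = 0) -> x = 0) ->
  injective prodmap.
Proof.
move=> h0 x y /ffunP xy; apply/eqP; rewrite -subr_eq0; apply/eqP/h0 => i.
by have := xy i; rewrite !ffunE rmorphB /= => ->; rewrite subrr.
Qed.

Hypothesis h_const : forall y, exists x, forall i, h i x = y.
Hypothesis h_sep : forall i k, i != k -> exists x, h i x != h k x.

Lemma prodmap_indicator k : exists x, forall i, h i x = (i == k)%:R.
Proof.
have /choice[C CE] := h_const.
have /choice[X XE] : forall i, exists x, i != k -> h k x != h i x.
  move=> i; have [->|/h_sep[x xE]] := eqVneq i k; first by exists 0.
  by exists x; rewrite eq_sym.
exists (\prod_(i | i != k)
  ((X i - C (h i (X i))) * C ((h k (X i) - h i (X i))^-1))) => l.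
rewrite rmorph_prod /=; have [->|lk] := eqVneq l k.
  rewrite big1 // => i ik.
  by rewrite rmorphM rmorphB /= !CE divff ?subr_eq0 ?XE.
by rewrite (bigD1 l) //= rmorphM rmorphB /= CE subrr !mul0r.
Qed.

Lemma prodmap_surj F : exists x, F = prodmap x.
Proof.
have /choice[D DE] := prodmap_indicator; have /choice[C CE] := h_const.
exists (\sum_i D i * C (F i)); apply/ffunP=> i.
rewrite ffunE rmorph_sum (bigD1 i) //= rmorphM /= DE CE eqxx mul1r.
by rewrite big1 ?addr0 // => k /negPf ki; rewrite rmorphM /= DE eq_sym ki mul0r.
Qed.

End ProductMap.

Section SpanningSubfamily.
Variables (K : fieldType) (p : nat) (pK : p \in [pchar K]).
Variables (n r : nat) (f : 'I_n -> K) (e : 'I_r -> 'I_n).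

Local Notation g := (fun k => f (e k)).

Hypothesis f_span : AS_spans p g f.

Definition AS_incl : ASalg pK g -> ASalg pK f :=
  ASlift (b := fun k => ASvar pK f (e k)) (fun k => ASvar_solution pK f (e k)).

HB.instance Definition _ := GRing.LRMorphism.on AS_incl.

Lemma AS_incl_var k : AS_incl (ASvar pK g k) = ASvar pK f (e k).
Proof. exact: ASlift_var. Qed.

Lemma AS_incl_inj : injective e -> injective AS_incl.
Proof.
move=> e_inj.
have /choice[b bE] : forall j, exists b : ASalg pK g,
    b ^+ p - b = (f j)%:A /\ forall k, e k = j -> b = ASvar pK g k.
  move=> j; have [/codomP[k ->]|j_codom] := boolP (j \in codom e).
    exists (ASvar pK g k); split=> [|k' /e_inj->//].
    exact: (ASvar_solution pK g).
  have [c [y ->]] := f_span j.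
  exists (\sum_k ASvar pK g k *+ c k + y%:A); split.
    exact/AS_lincomb/ASvar_solution.
  by move=> k ek; rewrite -ek codom_f in j_codom.
pose retraction : {lrmorphism ASalg pK f -> ASalg pK g} :=
  ASlift (b := b) (fun j => proj1 (bE j)).
apply: (can_inj (g := retraction)).
apply: (ASalg_hom_ext (h := retraction \o AS_incl) (h' := idfun)) => k.
by rewrite /= AS_incl_var ASlift_var; apply: (proj2 (bE (e k))).
Qed.

Variables (L : fieldExtType K) (alpha : 'I_n -> L).
Hypothesis alphaAS : AS_solution p f alpha.

Lemma generates_subfamily :
  generates alpha -> generates (fun k => alpha (e k)).
Proof.
move=> alpha_gen S subS Se; apply: alpha_gen => // j.
have [c [y fj]] := f_span j.
have alpha_jAS : alpha j ^+ p - alpha j =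
  (\sum_k f (e k) *+ c k + (y ^+ p - y))%:A by rewrite -fj.
have [c' ->] := AS_root_translate pK alpha_jAS
  (AS_lincomb pK c y (b := fun k => alpha (e k)) (fun k => alphaAS (e k))).
apply: subalgebraD => //; last by rewrite -Fp_embed_alg; apply: subalgebra_alg.
apply: subalgebraD => //; last exact: subalgebra_alg.
by apply: subalgebra_sum => // k; apply: subalgebraMn.
Qed.

End SpanningSubfamily.

Section Decomposition.
Variables (K : fieldType) (p : nat) (pK : p \in [pchar K]).
Variables (m : nat) (f : 'I_m.+1 -> K).
Hypothesis f_indep : moore p f != 0.
Variables (L : splittingFieldType K) (alpha : 'I_m.+1 -> L).
Hypotheses (alphaAS : AS_solution p f alpha) (alpha_gen : generates alpha).
Hypothesis galL : galois 1%VS {:L}.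
Variables (r : nat) (e : 'I_r -> 'I_m.+1).
Hypothesis e_inj : injective e.

Local Notation A := (ASalg pK f).
Local Notation g := (fun k => f (e k)).
Local Notation ffT := {ffun 'I_m.+1 -> 'F_p}.
Local Notation Fp_in := (Fp_embed (pchar_alg pK L)).

Hypotheses (g_free : AS_free p g) (f_span : AS_spans p g f).

Let betaAS : AS_solution p g (fun k => alpha (e k)) :=
  fun k => alphaAS (e k).

Let beta_gen := generates_subfamily pK f_span alphaAS alpha_gen.

Definition basis_point : {lrmorphism ASalg pK g -> L} := ASlift betaAS.

Definition transversal_shifts : {set ffT} :=
  [set c : ffT | [forall k, c (e k) == 0]].

Lemma card_transversal_shifts : #|transversal_shifts| = (p ^ (m.+1 - r))%N.
Proof.
pose T := ~: [set e k | k : 'I_r].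
have -> : #|transversal_shifts| = #|pffun_on (0 : 'F_p) (mem T) predT|.
  apply: eq_card => c; rewrite inE.
  apply/forallP/pffun_onP => [c0|[c_supp _] k].
    split=> //; apply/subsetP=> j; rewrite supportE !inE.
    by apply: contra => /imsetP[k _ ->].
  apply: contraT => ck; have := subsetP c_supp _ ck.
  by rewrite inE imset_f.
rewrite card_pffun_on cardT -cardT card_Fp ?(pcharf_prime pK) //.
by rewrite cardsCs setCK card_imset // !card_ord.
Qed.

Lemma basis_point_transversal b (x : ASalg pK g) : b \in transversal_shifts ->
  point alphaAS b (AS_incl x) = basis_point x.
Proof.
rewrite inE => /forallP b0; move: x.
apply: (ASalg_hom_ext (h := point alphaAS b \o AS_incl (e := e))) => k.
by rewrite /= AS_incl_var ASlift_var point_var (eqP (b0 k)) rmorph0 addr0.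
Qed.

Lemma point_conj_transversal c : exists (s : gal_of {:L}) (b : ffT),
  b \in transversal_shifts /\
  forall x : A, s (point alphaAS c x) = point alphaAS b x.
Proof.
have [s sE] := gal_shift_surj pK galL betaAS g_free (- \row_k c (e k)).
have [b bE] := lrmorph_point alphaAS (s \o point alphaAS c).
exists s, b; split=> //; rewrite inE; apply/forallP=> k.
rewrite -(fmorph_eq0 Fp_in) -(inj_eq (addrI (alpha (e k)))) addr0; apply/eqP.
rewrite -(point_var pK alphaAS b) -bE /= point_var rmorphD /= lrmorph_Fp_embed.
by rewrite (gal_shiftE pK betaAS) sE !mxE -addrA -rmorphD addNr rmorph0 addr0.
Qed.

Lemma basis_point_inj : injective basis_point.
Proof.
apply: raddf_inj => x x0; apply: (AS_incl_inj f_span e_inj).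
rewrite rmorph0; apply: (points_separate f_indep (alphaAS := alphaAS)) => c.
have [s [b [bT sE]]] := point_conj_transversal c.
apply/eqP; rewrite -(fmorph_eq0 s) /= sE.
by rewrite basis_point_transversal // x0.
Qed.

Lemma basis_point_surj y : exists x, y = basis_point x.
Proof.
apply: (generates_surj beta_gen) => k.
by exists (ASvar pK g k); rewrite /= ASlift_var.
Qed.

Lemma basis_point_bij : bijective basis_point.
Proof. exact: inj_surj_bij basis_point_inj basis_point_surj. Qed.

Definition transversal_point (i : 'I_#|transversal_shifts|) :
    {lrmorphism A -> L} :=
  point alphaAS (enum_val i).

Lemma transversal_points_separate x :
  (forall i, transversal_point i x = 0) -> x = 0.
Proof.
move=> x0; apply: (points_separate f_indep (alphaAS := alphaAS)) => c.
have [s [b [bT sE]]] := point_conj_transversal c.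
apply/eqP; rewrite -(fmorph_eq0 s) /= sE -(enum_rankK_in bT bT).
exact/eqP/x0.
Qed.

Lemma transversal_prodmap_surj F : exists x, F = prodmap transversal_point x.
Proof.
apply: prodmap_surj => [y|i k ik].
  have [x ->] := basis_point_surj y; exists (AS_incl x) => i.
  exact/basis_point_transversal/enum_valP.
have [j jE] : exists j, enum_val i j != enum_val k j.
  apply/existsP; apply: contraR ik => /existsPn eq_ik.
  by apply/eqP/enum_val_inj/ffunP => j; apply/eqP/negPn/eq_ik.
exists (ASvar pK f j); rewrite /= !point_var (inj_eq (addrI _)).
by rewrite (inj_eq (fmorph_inj _)).
Qed.

Lemma ASalg_decomposition :
  exists phi : {lrmorphism A -> {ffun 'I_(p ^ (m.+1 - r)) -> L}}, bijective phi.
Proof.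
rewrite -card_transversal_shifts; exists (prodmap transversal_point).
exact: inj_surj_bij (prodmap_inj transversal_points_separate)
  transversal_prodmap_surj.
Qed.

End Decomposition.

(** * Automorphisms of a power of a field *)

Section PowerEndomorphism.
Variables (R : idomainType) (I : finType).

Lemma orthogonal_partition_unity (a : I -> R) :
  (forall i k, i != k -> a i * a k = 0) -> \sum_i a i = 1 ->
  exists k0, forall k, a k = (k == k0)%:R.
Proof.
move=> a_orth a_sum; have [k0 ak0] : exists k0, a k0 != 0.
  apply/existsP; apply: contraT => /existsPn a0.
  have := oner_eq0 R; rewrite -a_sum big1 ?eqxx // => i _.
  exact/eqP/negPn/a0.
have a_eq0 k : k != k0 -> a k = 0.
  by move/a_orth/eqP; rewrite mulf_eq0 (negPf ak0) orbF => /eqP.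
exists k0 => k; have [->|/a_eq0//] := eqVneq k k0.
by rewrite -a_sum (bigD1 k0) //= big1 ?addr0.
Qed.

Definition ffun_delta (k : I) : {ffun I -> R} := [ffun i => (i == k)%:R].

Lemma mulr_ffun_delta (F : {ffun I -> R}) k :
  F * ffun_delta k = [ffun=> F k] * ffun_delta k.
Proof.
by apply/ffunP=> i; rewrite !ffunE; case: eqP => [->|_]; rewrite ?mulr0.
Qed.

Lemma ffun_delta_orthogonal i k :
  i != k -> ffun_delta i * ffun_delta k = 0.
Proof.
move=> ik; apply/ffunP=> l; rewrite !ffunE; case: eqP => [->|_].
  by rewrite (negPf ik) mulr0.
by rewrite mul0r.
Qed.

Lemma sum_ffun_delta : \sum_k ffun_delta k = 1.
Proof.
apply/ffunP=> l; rewrite sum_ffunE !ffunE (bigD1 l) //= ffunE eqxx.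
by rewrite big1 ?addr0 // => k /negPf kl; rewrite ffunE eq_sym kl.
Qed.

Lemma ffun_delta_neq0 k : ffun_delta k != 0.
Proof.
by apply/eqP=> /ffunP/(_ k)/eqP; rewrite !ffunE eqxx oner_eq0.
Qed.

(* The permutation is the action of H on the primitive idempotents. *)
Lemma ffun_endo_perm (H : {rmorphism {ffun I -> R} -> {ffun I -> R}}) :
  injective H ->
  exists t : {perm I}, forall F i, H F i = H [ffun=> F (t i)] i.
Proof.
move=> H_inj.
have /choice[t tE] : forall i, exists k0, forall k,
    H (ffun_delta k) i = (k == k0)%:R.
  move=> i; pose a k : R := H (ffun_delta k) i.
  apply: (orthogonal_partition_unity (a := a)).
    move=> k l /ffun_delta_orthogonal/(congr1 H)/ffunP/(_ i).
    by rewrite rmorphM rmorph0 !ffunE.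
  have := congr1 (fun F => H F i) sum_ffun_delta.
  by rewrite /= rmorph_sum rmorph1 sum_ffunE ffunE.
have /choice[u uK] : forall k, exists i, t i = k.
  move=> k; have /existsP[i] : [exists i, H (ffun_delta k) i != 0].
    apply: contraT => /existsPn Hk; have /eqP[] := ffun_delta_neq0 k.
    apply: H_inj; rewrite rmorph0; apply/ffunP=> i; rewrite ffunE.
    exact/eqP/negPn/Hk.
  rewrite tE; have [->|_] := eqVneq k (t i); first by exists i.
  by rewrite eqxx.
have t_inj : injective t := can_inj (canF_sym uK).
exists (perm t_inj) => F i; rewrite permE.
have HE G : H G i = (H (G * ffun_delta (t i))) i.
  by rewrite rmorphM ffunE tE eqxx mulr1.
by rewrite HE [RHS]HE mulr_ffun_delta [in RHS]mulr_ffun_delta ffunE.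
Qed.

End PowerEndomorphism.

Section PermutationAction.
Variables (gT : finGroupType) (N : nat).

Definition permute_fun (x : {dffun forall i : 'I_N, gT}) (a : 'S_N) :
  {dffun forall i : 'I_N, gT} := [ffun i => x ((a^-1)%g i)].

Fact permute_fun1 : permute_fun^~ 1%g =1 id.
Proof. by move=> x; apply/ffunP=> i; rewrite ffunE invg1 perm1. Qed.

Fact permute_funM x : act_morph permute_fun x.
Proof. by move=> a b; apply/ffunP=> i; rewrite !ffunE invMg permM. Qed.

Definition permute_action := TotalAction permute_fun1 permute_funM.

Fact permute_is_groupAction :
  is_groupAction [set: {dffun forall i : 'I_N, gT}] permute_action.
Proof.
move=> a _; rewrite inE; apply/andP; split.
  by apply/subsetP=> x; rewrite inE.
by apply/morphicP=> x y _ _; rewrite !actpermE; apply/ffunP=> i; rewrite !ffunE.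
Qed.

Definition permute_groupAction := GroupAction permute_is_groupAction.

End PermutationAction.

Section WreathProduct.
Variables (K : fieldType) (L : fieldExtType K) (gT : finGroupType) (N : nat).
Variable Psi : gT -> {lrmorphism L -> L}.
Hypothesis PsiM : forall s t, Psi (s * t)%g =1 Psi s \o Psi t.
Hypothesis Psi_inj : forall s t, Psi s =1 Psi t -> s = t.
Hypothesis Psi_onto : forall h : {lrmorphism L -> L}, bijective h ->
  exists s, Psi s =1 h.

Local Notation G := (sdprod_by (permute_groupAction gT N)).
Local Notation LN := {ffun 'I_N -> L}.

Definition wreath (u : G) (F : LN) : LN :=
  [ffun i => Psi (u.2 (u.1 i)) (F (u.1 i))].

Fact wreath_zmod_morphism u : zmod_morphism (wreath u).
Proof. by move=> F F'; apply/ffunP=> i; rewrite !ffunE rmorphB. Qed.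

Fact wreath_monoid_morphism u : monoid_morphism (wreath u).
Proof.
by split=> [|F F']; apply/ffunP=> i; rewrite !ffunE ?rmorph1 ?rmorphM.
Qed.

HB.instance Definition _ u :=
  GRing.isZmodMorphism.Build LN LN (wreath u) (wreath_zmod_morphism u).
HB.instance Definition _ u :=
  GRing.isMonoidMorphism.Build LN LN (wreath u) (wreath_monoid_morphism u).

Lemma wreathZ u : scalable (wreath u).
Proof. by move=> a F; apply/ffunP=> i; rewrite !ffunE linearZ. Qed.

Lemma wreathM u v : wreath (u * v)%g =1 wreath u \o wreath v.
Proof.
by move=> F; apply/ffunP=> i; rewrite !ffunE /= permM -[RHS]PsiM permK.
Qed.

Lemma wreath1 : wreath 1%g =1 id.
Proof.
move=> F; apply/ffunP=> i; rewrite ffunE /= perm1 ffunE.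
by apply: (fmorph_inj (Psi 1%g)); rewrite -[LHS]PsiM mulg1.
Qed.

Lemma wreath_inj u v : wreath u =1 wreath v -> u = v.
Proof.
move=> uv; have uv1 : u.1 = v.1.
  apply/permP=> i; have /ffunP/(_ i) := uv (ffun_delta L (v.1 i)).
  rewrite !ffunE eqxx rmorph1 rmorph_nat; case: eqP => // _ /eqP.
  by rewrite eq_sym oner_eq0.
apply/val_inj; rewrite [val u]surjective_pairing [val v]surjective_pairing.
congr (_, _) => //; apply/ffunP=> i; apply: Psi_inj => y.
have /ffunP/(_ ((u.1^-1)%g i)) := uv [ffun=> y].
by rewrite !ffunE -uv1 permKV.
Qed.

Section Surjectivity.
Variable H : {rmorphism LN -> LN}.
Hypotheses (HZ : scalable H) (H_bij : bijective H).

Definition factor_endo (i : 'I_N) (y : L) : L := H [ffun=> y] i.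

Fact factor_endo_zmod_morphism i : zmod_morphism (factor_endo i).
Proof.
move=> y z; have -> : factor_endo i (y - z) = H ([ffun=> y] - [ffun=> z]) i.
  by congr (H _ i); apply/ffunP=> k; rewrite !ffunE.
by rewrite rmorphB !ffunE.
Qed.

Fact factor_endo_monoid_morphism i : monoid_morphism (factor_endo i).
Proof.
split=> [|y z].
  have -> : factor_endo i 1 = H 1 i.
    by congr (H _ i); apply/ffunP=> k; rewrite !ffunE.
  by rewrite rmorph1 ffunE.
have -> : factor_endo i (y * z) = H ([ffun=> y] * [ffun=> z]) i.
  by congr (H _ i); apply/ffunP=> k; rewrite !ffunE.
by rewrite rmorphM !ffunE.
Qed.

Fact factor_endo_scalable i : scalable (factor_endo i).
Proof.
move=> a y; have -> : factor_endo i (a *: y) = H (a *: [ffun=> y]) i.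
  by congr (H _ i); apply/ffunP=> k; rewrite !ffunE.
by rewrite HZ ffunE.
Qed.

HB.instance Definition _ i := GRing.isZmodMorphism.Build L L
  (factor_endo i) (factor_endo_zmod_morphism i).
HB.instance Definition _ i := GRing.isMonoidMorphism.Build L L
  (factor_endo i) (factor_endo_monoid_morphism i).
HB.instance Definition _ i := GRing.isScalable.Build K L L *:%R
  (factor_endo i) (factor_endo_scalable i).

Lemma wreath_onto : exists u, wreath u =1 H.
Proof.
have [t tE] := ffun_endo_perm (bij_inj H_bij).
have factor_bij i : bijective (factor_endo i).
  apply: inj_surj_bij => [|y]; first exact: fmorph_inj.
  have [H' _ HK] := H_bij; exists (H' [ffun=> y] (t i)).
  by rewrite /factor_endo -tE HK ffunE.
have /choice[s sE] := fun i => Psi_onto (factor_bij i).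
pose v : {dffun forall i : 'I_N, gT} := [ffun j => s ((t^-1)%g j)].
have uP : (t, v) \in setX [set: 'S_N] [set: {dffun forall i : 'I_N, gT}].
  by rewrite !inE.
exists (SdPair (permute_groupAction gT N) uP) => F; apply/ffunP=> i.
by rewrite !ffunE /= permK sE tE.
Qed.

End Surjectivity.

Variables (A : comAlgType K) (phi : {lrmorphism A -> LN}).
Variable phi' : {rmorphism LN -> A}.
Hypotheses (phiK : cancel phi phi') (phi'K : cancel phi' phi).

Definition wreath_conj (u : G) : A -> A := phi' \o (wreath u \o phi).

Fact wreath_conj_scalable u : scalable (wreath_conj u).
Proof.
move=> a x; apply: (can_inj phiK).
by rewrite /wreath_conj /= linearZ /= !phi'K wreathZ linearZ /= phi'K.
Qed.

HB.instance Definition _ u := GRing.RMorphism.on (wreath_conj u).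
HB.instance Definition _ u := GRing.isScalable.Build K A A *:%R
  (wreath_conj u) (wreath_conj_scalable u).

Lemma wreath_conjM u v :
  wreath_conj (u * v)%g =1 wreath_conj u \o wreath_conj v.
Proof. by move=> x; rewrite /wreath_conj /= wreathM /= phi'K. Qed.

Lemma wreath_conj1 : wreath_conj 1%g =1 id.
Proof. by move=> x; rewrite /wreath_conj /= wreath1 phiK. Qed.

Lemma wreath_conj_bij u : bijective (wreath_conj u).
Proof.
exists (wreath_conj u^-1%g) => x.
  by rewrite -[LHS]wreath_conjM mulVg wreath_conj1.
by rewrite -[LHS]wreath_conjM mulgV wreath_conj1.
Qed.

Lemma Aut_isog_wreath : Aut_isog A G.
Proof.
exists wreath_conj; split=> [u|u v|u v uv|h h_bij].
- exact: wreath_conj_bij.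
- exact: wreath_conjM.
- apply: wreath_inj => F; apply: (can_inj phi'K).
  by have := uv (phi' F); rewrite /= /wreath_conj /= phi'K.
- have H_bij : bijective (phi \o (h \o phi')).
    by apply: bij_comp; [exists phi'|apply: bij_comp; [|exists phi]].
  have HZ : scalable (phi \o (h \o phi')).
    move=> a F; rewrite /= -!linearZ; congr (phi (h _)).
    by apply: (can_inj phiK); rewrite linearZ /= !phi'K.
  have [u uE] := wreath_onto HZ H_bij; exists u => x.
  by rewrite /= /wreath_conj /= uE /= !phiK.
Qed.

End WreathProduct.

Lemma Aut_isog_power (K : fieldType) (L : fieldExtType K) (gT : finGroupType)
    (N : nat) (A : comAlgType K) (phi : {lrmorphism A -> {ffun 'I_N -> L}}) :
  Aut_isog L gT -> bijective phi ->
  Aut_isog A (sdprod_by (permute_groupAction gT N)).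
Proof.
move=> [Psi [_ PsiM Psi_inj Psi_onto]] [psi phiK psiK].
pose psi_add := GRing.isZmodMorphism.Build _ _ psi
  (can2_zmod_morphism phiK psiK).
pose psi_mul := GRing.isMonoidMorphism.Build _ _ psi
  (can2_monoid_morphism phiK psiK).
pose phi' : {rmorphism {ffun 'I_N -> L} -> A} := HB.pack psi psi_add psi_mul.
exact: (Aut_isog_wreath PsiM Psi_inj Psi_onto (phi' := phi') phiK psiK).
Qed.

Lemma lrmorph_gal (K : fieldType) (L : splittingFieldType K)
    (h : {lrmorphism L -> L}) :
  galois 1%VS {:L} -> exists s : gal_of {:L}, s =1 h.
Proof.
case/and3P=> _ _ normL.
have h_kHom : kHom 1 {:L} (linfun h).
  apply/kHomP_tmp; split=> [_ /vlineP[a ->]|x y _ _].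
    by rewrite lfunE /= lrmorph_alg.
  by rewrite !lfunE /= rmorphM.
have L_sub : (1%AS <= {:L}%AS <= {:L}%AS)%VS by rewrite sub1v subvv.
have [s _ sE] := kHom_to_gal L_sub normL h_kHom.
by exists s => y; rewrite -sE ?memvf // lfunE.
Qed.

(* The inverse compensates for the order of composition: in the library
   (s * t) y = t (s y) for elements s and t of a Galois group. *)
Lemma Aut_isog_galois (K : fieldType) (L : splittingFieldType K)
    (gT : finGroupType) :
  galois 1%VS {:L} -> 'Gal({:L} / 1%VS)%g \isog [set: gT] -> Aut_isog L gT.
Proof.
move=> galL; rewrite Gal_fullE isog_sym => /isogP[sig /injmP sig_inj sig_im].
have sigM s t : sig (s * t)%g = (sig s * sig t)%g by rewrite morphM ?inE.
have sigK s t y : (s * t = 1)%g -> sig t (sig s y) = y.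
  by move=> st1; rewrite -galM ?memvf // -sigM st1 morph1 gal_id.
exists (fun s => sig s^-1%g : gal_of {:L}); split=> [s|s t y|s t st|h _].
- by exists (sig s) => y; apply: sigK; rewrite ?mulVg ?mulgV.
- by rewrite /= invMg sigM galM ?memvf.
- apply/invg_inj/sig_inj; rewrite ?inE //.
  by apply/eqP/gal_eqP => y _; apply: st.
- have [s sE] := lrmorph_gal h galL.
  have : s \in (sig @* [set: gT])%g by rewrite sig_im inE.
  by case/morphimP=> v _ _ sv; exists v^-1%g => y; rewrite invgK -sE sv.
Qed.

Theorem proposition5p2 (K : fieldType) (p : nat) (pK : p \in [pchar K])
    (Kalg : closedFieldType) (iota : {rmorphism K -> Kalg})
    (Kalg_algebraic : forall x : Kalg, algebraicOver iota x)
    (n : nat) (n_gt0 : (0 < n)%N) (f : 'I_n -> K)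
    (f_indep : moore p f != 0)
    (r : nat) (dimV : ASdim pK f r)
    (I J : {set 'I_n})
    (IJ_disjoint : [disjoint I & J]) (IJ_cover : I :|: J = [set: 'I_n])
    (I_basis :
      ASbasis f (fun k : 'I_#|I| => AScls pK (f (enum_val k)))) :
  let A := ASalg pK f in
  let N := (p ^ (n - r))%N in
  let wi : 'I_n -> A := ASvar pK f in
  let w : A := wdet p f wi in
  let d := dcoef p f in
  let Delta := moore p f in
  let Q := Qpoly p f in
  (r <= n)%N /\
  (etale A /\
   exists (L : splittingFieldType K) (j : {rmorphism L -> Kalg}),
     [/\ forall a : K, j a%:A = iota a,
         galois 1%VS {:L},
         'Gal({:L} / 1%VS) \isog [set: 'rV['F_p]_r],
         exists phi : {lrmorphism A -> {ffun 'I_N -> L}}, bijective phi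
       & exists psi : {lrmorphism
             ASalg pK (fun k : 'I_#|I| => f (enum_val k)) -> L},
           bijective psi]) /\
  (exists to : groupAction [set: 'S_N]
                 [set: {dffun forall i : 'I_N, 'rV['F_p]_r}],
     Aut_isog A (sdprod_by to)) /\
  [/\ moore p d != 0,
      forall i : 'I_n,
        wi i = (moore p d)^-1 *:
                 moore p (fun k : 'I_n => if k == i then w else (d k)%:A)
               - (\sum_(k < n.-1) f i ^+ (p ^ k))%:A
        /\ exists q : {poly K}, wi i = horner_alg w q,
      (forall a : A, exists q : {mpoly K[n]}, a = mmap (in_alg A) wi q) /\
      (forall a : A, exists q : {poly K}, a = horner_alg w q),
      horner_alg w Q = 0 /\
      (exists theta : {lrmorphism {poly %/ Q} -> A},
         bijective theta /\ theta 'qX = w)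
    & moore p (minor p f) != 0 /\
      Q = 'X^(p ^ n)
          + \sum_(1 <= i < n)
              ((-1) ^+ (n - i)
               * Delta ^ ((p ^ n.-1)%:Z - (p ^ i.-1)%:Z - (p ^ i)%:Z)
               * moore_omit p (n - i) f ^+ (p ^ i.-1)) *: 'X^(p ^ i)
          + ((-1) ^+ n * Delta ^+ (p ^ n.-1 - 1)) *: 'X
          - (Delta ^+ (p ^ n.-1))%:P].
Proof.
case: n n_gt0 f f_indep dimV I J IJ_disjoint IJ_cover I_basis => // m _.
move=> f f_indep dimV I J _ _ I_basis A N wi w d Delta Q.
have rE := ASdim_unique dimV I_basis; subst r.
have f_free := ASbasis_free I_basis; have f_span := ASbasis_spans I_basis.
have [L [j [alpha [jK alphaAS alpha_gen galL]]]] :=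
  AS_splitting_field pK Kalg_algebraic f_indep.
have gal_iso := Gal_isog pK galL (fun k => alphaAS (enum_val k))
  (generates_subfamily pK f_span alphaAS alpha_gen) f_free.
have [phi phi_bij] := ASalg_decomposition pK f_indep alphaAS alpha_gen galL
  enum_val_inj f_free f_span.
split; first by rewrite -[X in (_ <= X)%N](card_ord m.+1) max_card.
split; [split|split].
- by split; [apply: ASalg_finitely_presented|apply: ASalg_formally_etale].
- exists L, j; split=> //; first by exists phi.
  exists (basis_point pK alphaAS enum_val).
  exact: (basis_point_bij pK f_indep _ alpha_gen galL enum_val_inj f_free).
- exists (permute_groupAction _ N).
  exact: Aut_isog_power (Aut_isog_galois galL gal_iso) phi_bij.
- split; first exact: moore_dcoef_neq0.
  + by move=> i; split; [apply: ASvar_wdetE|apply: ASalg_horner].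
  + split; last exact: ASalg_horner.
    exact: generates_mmap (@ASvar_generates _ _ pK _ f).
  + by split; [apply: wdet_root|apply: qpoly_ASalg_iso].
  + by split; [apply: moore_minor_neq0|apply: Qpoly_explicit].
Qed.
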